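(* Let $Y=\xi+R\,\gamma+S\,X\sim\mathrm{GMN}_d(\xi,\Sigma,\gamma,H)$, and let $Y,\xi,\gamma,\Sigma$ be partitioned into blocks of sizes $d_1,d_2$, $d_1+d_2=d$, as $$Y=\begin{pmatrix}Y_1\\ Y_2\end{pmatrix},\quad \xi=\begin{pmatrix}\xi_1\\ \xi_2\end{pmatrix},\quad \gamma=\begin{pmatrix}\gamma_1\\ \gamma_2\end{pmatrix},\quad \Sigma=\begin{pmatrix}\Sigma_{11}&\Sigma_{12}\\ \Sigma_{21}&\Sigma_{22}\end{pmatrix}.$$ Suppose that $S=1$ with probability $1$, that $\Sigma_{12}=0$, and that at least one of $\gamma_1$ and $\gamma_2$ is $0$. Then $Y_1$ and $Y_2$ are independent. Moreover, in the case $\xi=0$, writing $c(t_1,t_2)=\mathbb{E}\{e^{i t_1^\top Y_1+i t_2^\top Y_2}\}$, $c_j(t_j)=\mathbb{E}\{e^{i t_j^\top Y_j}\}$ and $c_{N,j}(t_j)=e^{-\frac12 t_j^\top\Sigma_{jj}t_j}$ for $t_j\in\mathbb{R}^{d_j}$, $j=1,2$: (a) if $\gamma_1=0$, then $c(t_1,t_2)=c_{N,1}(t_1)\,c_2(t_2)$ for all $t_1,t_2$; (b) if $\gamma_2=0$, then $c(t_1,t_2)=c_1(t_1)\,c_{N,2}(t_2)$ for all $t_1,t_2$. If both $\gamma_1$ and $\gamma_2$ are $0$, then $Y_1$ and $Y_2$ are independent normal variables.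
   Context: Generalized mixtures of normals (GMN). Let $\Sigma$ be a $d\times d$ symmetric positive definite matrix and $\xi,\gamma\in\mathbb{R}^d$. Let $X\sim\mathrm{N}_d(0,\Sigma)$ be a $d$-dimensional normal variable and $U,V$ univariate random variables such that $X,U,V$ are mutually independent. Let $r(u,v)$ be a real-valued function and $s(u,v)$ a positive-valued function, and let $R=r(U,V)$, $S=s(U,V)$ be the resulting random variables, so that $(R,S)$ is independent of $X$. Denote by $H$ the joint distribution (function) of $(R,S)$. If $Y=\xi+R\,\gamma+S\,X$, one writes $Y\sim\mathrm{GMN}_d(\xi,\Sigma,\gamma,H)$; this notation identifies the distribution of $Y$. *)

(* Defs.v *)
From HB Require Import structures.
From mathcomp Require Import all_boot all_order all_algebra complex.
From mathcomp Require Import all_classical all_reals all_analysis.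

Set Implicit Arguments.
Unset Strict Implicit.
Unset Printing Implicit Defensive.

Import Order.TTheory GRing.Theory Num.Theory.
Import numFieldNormedType.Exports.

Local Open Scope classical_set_scope.
Local Open Scope ring_scope.
Local Open Scope complex_scope.

Definition measure_matrix_display : measure_display -> measure_display.
Proof. exact. Qed.

(* The sigma-algebra on matrices generated by the coordinate maps; over the
   reals it is the Borel sigma-algebra of the matrix topology. *)
Section measurable_matrix.
Context {d} {T : measurableType d}.
Variables m n : nat.

Definition mx_measurable : set (set 'M[T]_(m, n)) :=
  <<s \bigcup_(ij in [set: 'I_m * 'I_n])
        preimage_set_system setT (fun M : 'M[T]_(m, n) => M ij.1 ij.2)
          measurable >>.

Let mx_measurable0 : mx_measurable set0.
Proof. exact: sigma_algebra0. Qed.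

Let mx_measurableC A : mx_measurable A -> mx_measurable (~` A).
Proof. exact: sigma_algebraC. Qed.

Let mx_measurable_bigcup (F : _^nat) :
  (forall i, mx_measurable (F i)) -> mx_measurable (\bigcup_i F i).
Proof. exact: sigma_algebra_bigcup. Qed.

HB.instance Definition _ := @isMeasurable.Build (measure_matrix_display d)
  'M[T]_(m, n) mx_measurable mx_measurable0 mx_measurableC
  mx_measurable_bigcup.

End measurable_matrix.

Lemma measurable_mx_coord d (T : measurableType d) m n (i : 'I_m) (j : 'I_n) :
  measurable_fun [set: 'M[T]_(m, n)] (fun M : 'M[T]_(m, n) => M i j).
Proof.
move=> _ Y mY; rewrite setTI; apply: sub_sigma_algebra.
by exists (i, j) => //; exists Y => //; rewrite setTI.
Qed.

Lemma measurable_fun_mxP d d' (T : measurableType d) (T' : measurableType d')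
    m n (f : T' -> 'M[T]_(m, n)) :
  (forall i j, measurable_fun [set: T'] (fun x => f x i j)) ->
  measurable_fun [set: T'] f.
Proof.
move=> mf _ Y mY; rewrite setTI.
have : preimage_set_system [set: T'] f (@mx_measurable _ T m n) (f @^-1` Y).
  by exists Y => //; rewrite setTI.
rewrite /mx_measurable -g_sigma_preimageE; move: (f @^-1` Y).
apply: smallest_sub; first exact: sigma_algebra_measurable.
move=> _ [B [[i j] _ [C mC <-]] <-]; rewrite !setTI -comp_preimage.
by rewrite -[X in measurable X]setTI; exact: mf.
Qed.

Section lebesgue_cV.
Variable R : realType.

Section step.
Variable n : nat.

(* lebesgue_measure lives on measurableTypeR R, whose display differs from that
   of R although the sigma-algebra is the same. *)
Definition cV_cons (p : measurableTypeR R * 'cV[R]_n) : 'cV[R]_n.+1 :=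
  col_mx (const_mx p.1 : 'cV[R]_1) p.2.

Definition cV_uncons (v : 'cV[R]_n.+1) : measurableTypeR R * 'cV[R]_n :=
  (v ord0 ord0, dsubmx (v : 'cV[R]_(1 + n))).

Lemma cV_consK : cancel cV_cons cV_uncons.
Proof.
move=> [x v]; rewrite /cV_uncons /cV_cons /= col_mxKd; congr (_, _).
transitivity ((const_mx x : 'cV[R]_1) ord0 ord0); last by rewrite mxE.
rewrite -(col_mxEu (const_mx x : 'cV[R]_1) v); congr (col_mx _ _ _ _).
exact: val_inj.
Qed.

Lemma measurable_cV_cons :
  measurable_fun [set: measurableTypeR R * 'cV[R]_n] cV_cons.
Proof.
apply: measurable_fun_mxP => i j.
case: (split_ordP (i : 'I_(1 + n))) => k ->.
- rewrite (_ : (fun _ => _) = fst); first exact: measurable_fst.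
  by apply/funext => p; rewrite /cV_cons; apply: etrans (col_mxEu _ _ _ _) _;
    rewrite mxE.
- rewrite (_ : (fun _ => _) = (fun v : 'cV[R]_n => v k j) \o snd).
    exact: (measurableT_comp (measurable_mx_coord k j) measurable_snd).
  by apply/funext => p; exact: col_mxEd.
Qed.

Lemma measurable_cV_uncons : measurable_fun [set: 'cV[R]_n.+1] cV_uncons.
Proof.
apply/measurable_fun_pairP; split; first exact: measurable_mx_coord.
apply: measurable_fun_mxP => i j.
rewrite (_ : (fun _ => _) =
  (fun v : 'cV[R]_n.+1 => v (rshift 1 i : 'I_n.+1) j)).
  exact: measurable_mx_coord.
by apply/funext => v; rewrite /cV_uncons /= mxE.
Qed.

Variable nu : {sigma_finite_measure set 'cV[R]_n -> \bar R}.

Definition lebesgue_cVS : set 'cV[R]_n.+1 -> \bar R :=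
  pushforward (lebesgue_measure \x nu)%E cV_cons.

Let preimage_cV_cons_measurable (A : set 'cV[R]_n.+1) :
  measurable A -> measurable (cV_cons @^-1` A).
Proof.
by move=> mA; rewrite -[X in measurable X]setTI; exact: measurable_cV_cons.
Qed.

Let lebesgue_cVS0 : lebesgue_cVS set0 = 0%E.
Proof. by rewrite /lebesgue_cVS /pushforward preimage_set0 measure0. Qed.

Let lebesgue_cVS_ge0 A : (0 <= lebesgue_cVS A)%E.
Proof. by rewrite /lebesgue_cVS /pushforward measure_ge0. Qed.

Let lebesgue_cVS_sigma_additive : semi_sigma_additive lebesgue_cVS.
Proof.
move=> F mF tF mUF; rewrite /lebesgue_cVS /pushforward preimage_bigcup.
apply: measure_semi_sigma_additive.
- by move=> k; exact: preimage_cV_cons_measurable.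
- apply/trivIsetP => /= i j _ _ ij; rewrite -preimage_setI.
  by move/trivIsetP : tF => /(_ _ _ _ _ ij) ->//; rewrite preimage_set0.
- by rewrite -preimage_bigcup; exact: preimage_cV_cons_measurable.
Qed.

HB.instance Definition _ := isMeasure.Build _ _ _ lebesgue_cVS
  lebesgue_cVS0 lebesgue_cVS_ge0 lebesgue_cVS_sigma_additive.

Let lebesgue_cVS_sigma_finite : sigma_finite setT lebesgue_cVS.
Proof.
have /sigma_finiteP[F [TF ndF Foo]] := sigma_finiteT (@lebesgue_measure R).
have /sigma_finiteP[G [TG ndG Goo]] := sigma_finiteT nu.
exists (fun k => cV_uncons @^-1` (F k `*` G k)).
  apply/seteqP; split => // v _.
  have : [set: measurableTypeR R] (cV_uncons v).1 by [].
  have : [set: 'cV[R]_n] (cV_uncons v).2 by [].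
  rewrite TF TG => -[k _ Gk] [l _ Fl]; exists (maxn k l) => //; split.
  - by move: Fl; exact/subsetPset/ndF/leq_maxr.
  - by move: Gk; exact/subsetPset/ndG/leq_maxl.
move=> k; have [mF Fk] := Foo k; have [mG Gk] := Goo k; split.
  rewrite -[X in measurable X]setTI.
  by apply: measurable_cV_uncons => //; exact: measurableX.
rewrite /lebesgue_cVS /pushforward -comp_preimage.
rewrite (_ : cV_uncons \o cV_cons = id); last exact/funext/cV_consK.
by rewrite preimage_id product_measure1E// lte_mul_pinfty// ge0_fin_numE.
Qed.

HB.instance Definition _ :=
  Measure_isSigmaFinite.Build _ _ _ lebesgue_cVS lebesgue_cVS_sigma_finite.

End step.

(* n-dimensional Lebesgue measure on column vectors: the n-fold product of
   lebesgue_measure, transported along R * R^n' ~ R^n'.+1; the one-point space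
   R^0 has mass 1. *)
Fixpoint lebesgue_cV n : {sigma_finite_measure set 'cV[R]_n -> \bar R} :=
  match n with
  | 0 => [the {sigma_finite_measure set 'cV[R]_0 -> \bar R} of dirac (0 : 'cV[R]_0)]
  | n'.+1 => [the {sigma_finite_measure set 'cV[R]_n'.+1 -> \bar R} of
                lebesgue_cVS (lebesgue_cV n')]
  end.

End lebesgue_cV.

(* The product rule over all triples of events also covers every subfamily,
   since each event may be the whole space. *)
Definition independent3 dO d1 d2 d3 (Omega : measurableType dO)
    (T1 : measurableType d1) (T2 : measurableType d2) (T3 : measurableType d3)
    (R : realType) (P : probability Omega R)
    (X : Omega -> T1) (Y : Omega -> T2) (Z : Omega -> T3) : Prop :=
  forall A B C, measurable A -> measurable B -> measurable C ->
    (P (X @^-1` A `&` Y @^-1` B `&` Z @^-1` C) =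
     P (X @^-1` A) * P (Y @^-1` B) * P (Z @^-1` C))%E.

Definition independent2 dO d1 d2 (Omega : measurableType dO)
    (T1 : measurableType d1) (T2 : measurableType d2)
    (R : realType) (P : probability Omega R)
    (X : Omega -> T1) (Y : Omega -> T2) : Prop :=
  forall A B, measurable A -> measurable B ->
    (P (X @^-1` A `&` Y @^-1` B) = P (X @^-1` A) * P (Y @^-1` B))%E.

Section multivariate_normal.
Variables (R : realType) (n : nat).
Implicit Types (x y mu : 'cV[R]_n) (Sigma : 'M[R]_n).

Definition dotv x y : R := (x^T *m y) ord0 ord0.

Definition symmetric_posdef Sigma : Prop :=
  Sigma^T = Sigma /\ forall x, x != 0 -> 0 < dotv x (Sigma *m x).

Definition mvnormal_pdf mu Sigma x : R :=
  (Num.sqrt ((2 * pi) ^+ n * \det Sigma))^-1 *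
  expR (- (dotv (x - mu) (invmx Sigma *m (x - mu)) / 2)).

(* X ~ N_n(mu, Sigma), via its density; meant for Sigma symmetric positive definite. *)
Definition mvnormal dO (Omega : measurableType dO) (P : probability Omega R)
    mu Sigma (X : Omega -> 'cV[R]_n) : Prop :=
  forall B : set 'cV[R]_n, measurable B ->
    P (X @^-1` B) =
    (\int[@lebesgue_cV R n]_(x in B) (mvnormal_pdf mu Sigma x)%:E)%E.

End multivariate_normal.

(* H is a law on R * R and is compared with the joint law of (r(U,V), s(U,V))
   on Borel sets; r and s are Borel, so that (r(U,V), s(U,V)) is a random pair
   independent of X.
   Y = xi + r(U,V) gamma + s(U,V) X represents GMN_n(xi, Sigma, gamma, H). *)
Record GMN (R : realType) dO (Omega : measurableType dO)
    (P : probability Omega R) (n : nat) (xi : 'cV[R]_n) (Sigma : 'M[R]_n)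
    (gamma : 'cV[R]_n) (H : probability (R * R)%type R)
    (X : {RV P >-> 'cV[R]_n}) (U V : {RV P >-> R})
    (r s : {mfun (R * R)%type >-> R}) (Y : Omega -> 'cV[R]_n) : Prop := {
  GMN_Sigma : symmetric_posdef Sigma;
  GMN_X : mvnormal P 0 Sigma X;
  GMN_indep : independent3 P X U V;
  GMN_s_gt0 : forall u v, 0 < s (u, v);
  GMN_H : forall B : set (R * R), measurable B ->
    H B = P [set w | B (r (U w, V w), s (U w, V w))];
  GMN_Y : forall w, Y w = xi + r (U w, V w) *: gamma + s (U w, V w) *: X w
}.

Section characteristic_function.
Variable R : realType.

(* exp(x + iy) = exp(x) (cos y + i sin y) *)
Definition cexp (z : R[i]) : R[i] :=
  (expR (complex.Re z))%:C *
  (cos (complex.Im z) +i* sin (complex.Im z)).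

(* E(Z) = E(Re Z) + i E(Im Z), meant for Z with integrable real and imaginary
   parts *)
Definition cexpectation dO (Omega : measurableType dO)
    (P : probability Omega R) (Z : Omega -> R[i]) : R[i] :=
  fine 'E_P[fun w => complex.Re (Z w)] +i*
  fine 'E_P[fun w => complex.Im (Z w)].

Definition cf dO (Omega : measurableType dO) (P : probability Omega R)
    n (Y : Omega -> 'cV[R]_n) (t : 'cV[R]_n) : R[i] :=
  cexpectation P (fun w => cexp ('i * (dotv t (Y w))%:C)).

Definition joint_cf dO (Omega : measurableType dO) (P : probability Omega R)
    n1 n2 (Y1 : Omega -> 'cV[R]_n1) (Y2 : Omega -> 'cV[R]_n2)
    (t1 : 'cV[R]_n1) (t2 : 'cV[R]_n2) : R[i] :=
  cexpectation P (fun w =>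
    cexp ('i * (dotv t1 (Y1 w))%:C + 'i * (dotv t2 (Y2 w))%:C)).

Definition normal_cf n (Sigma : 'M[R]_n) (t : 'cV[R]_n) : R[i] :=
  cexp (- (2^-1 * dotv t (Sigma *m t))%:C).

End characteristic_function.

(* Main.v *)
Require Import Defs.
From HB Require Import structures.
From mathcomp Require Import all_boot all_order all_algebra complex.
From mathcomp Require Import all_classical all_reals all_analysis.
From mathcomp Require Import measurable_realfun ring lra.

Set Implicit Arguments.
Unset Strict Implicit.
Unset Printing Implicit Defensive.

Import Order.TTheory GRing.Theory Num.Theory.
Import numFieldNormedType.Exports.

Local Open Scope classical_set_scope.
Local Open Scope ring_scope.

(** On the event S = 1, which has probability one, Y = xi + R gamma + X.  Write
    X1, X2 for the blocks of X and W = (U, V).  When Sigma12 = 0 the inverse and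
    the determinant of Sigma split blockwise, so the density of X is a product
    (mvnormal_pdf_block_diag); as Lebesgue measure on R^(d1 + d2) is a product
    as well (ge0_integral_lebesgue_cV_add), X1 and X2 are independent normal
    vectors.  As X is moreover independent of W, the block X1 is independent of
    the pair (X2, W).  If gamma1 = 0 then, almost surely, Y1 = xi1 + X1 and Y2 is a
    function of (X2, W): the two blocks are independent.  The case gamma2 = 0
    exchanges the two blocks, and when gamma1 = gamma2 = 0 each block is a
    translate of a normal vector.

    For the characteristic functions one needs that of a normal vector.  A real
    formulation is used throughout: for every phase c,

      E cos (t . X + c) = exp (- t . Sigma t / 2) cos c,

    whose cases c = 0 and c = - pi / 2 are the real and imaginary parts.  The
    phase makes the formula stable under iteration: integrating out one
    coordinate of a vector turns the others into a phase, so the formula on R^n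
    follows by induction on n from the one on R, by completing the square and
    passing to the Schur complement of the precision matrix
    (integral_gauss_cV_wave).  In the same way, in E cos (t1 . Y1 + t2 . Y2) the
    independent block Y2 only enters through a phase (Rintegral_normal_phase),
    and the product formula for the characteristic function drops out of
    Fubini's theorem.  On the line, the left-hand side of the formula solves
    G' = - s^2 t G as a function of t, by Stein's identity (normal_cos_phase).

    The integrands are the nonnegative functions a + b cos with |b| <= a rather
    than cosines alone, so that every exchange of integrals is an instance of
    Tonelli's theorem; the case b = 0 is the normalisation of the density. *)

(** * Gaussian integrals of cosine waves on the line *)

Section gauss_line.
Context {R : realType}.
Local Notation mu := (@lebesgue_measure R).

(** The integral of f over [m - n, m + n] is F (m + n) - F (m - n), which is
    O(1 / n) by the last hypothesis; dominated convergence carries this to the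
    whole line.  It serves as integration by parts without boundary terms. *)
Lemma integral_derive_eq0 (F f : R -> R) (m K : R) :
  (forall x : R, is_derive x (1 : R) F (f x)) -> continuous f ->
  mu.-integrable [set: R] (EFin \o f) ->
  (forall x, `|x - m| * `|F x| <= K) ->
  \int[mu]_x f x = 0.
Proof.
move=> dF cf intf FK.
pose J (n : nat) : set R := `[m - n.+1%:R, m + n.+1%:R]%classic.
have mJ n : measurable (J n) by exact: measurable_itv.
have mf : measurable_fun [set: R] f by exact: continuous_measurable_fun.
pose g n : R -> \bar R := (EFin \o f) \_ (J n).
have gE n x : g n x = ((f x) * \1_(J n) x)%:E.
  by rewrite /g patchE indicE; case: ifPn => _ /=; rewrite ?mulr1 ?mulr0.
have [_ _ cvgi] : [/\ mu.-integrable [set: R] (EFin \o f),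
    (\int[mu]_x `|g n x - (EFin \o f) x| @[n --> \oo] --> 0)%E
  & (\int[mu]_x g n x @[n --> \oo] --> \int[mu]_x (EFin \o f) x)%E].
  apply: (@dominated_convergence _ _ _ mu _ measurableT g _
    (fun x => `|(f x)%:E|%E)).
  - move=> n; rewrite (funext (gE n)); apply/measurable_EFinP.
    apply: measurable_funM; [exact: mf|exact: (measurable_indic (mJ n))].
  - exact/measurable_EFinP.
  - apply: aeW => x _; apply: cvg_near_cst.
    exists (Num.truncn `|x - m|) => // n /= xn.
    rewrite gE indicE mem_set ?mulr1// /J /= in_itv/=.
    have : `|x - m| < n.+1%:R.
      by rewrite (lt_le_trans (truncnS_gt _))// ler_nat.
    by rewrite ltr_norml => /andP[? ?]; apply/andP; split; lra.
  - by apply: integrable_abse.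
  - apply: aeW => x n _; rewrite gE /= lee_fin normrM indicE.
    by case: (_ \in _); rewrite ?normr1 ?mulr1 ?normr0 ?mulr0.
have Ig n : (\int[mu]_x g n x)%E = (F (m + n.+1%:R) - F (m - n.+1%:R))%:E.
  rewrite /g -integral_mkcond (@continuous_FTC2 _ f F) ?EFinB//.
  - by have := ltr0Sn R n; lra.
  - exact: continuous_subspaceT.
  - have cF x : {for x, continuous F}.
      by apply/differentiable_continuous/derivable1_diffP; case: (dF x).
    split.
    + by move=> x _; case: (dF x).
    + exact/cvg_at_right_filter/cF.
    + exact/cvg_at_left_filter/cF.
  - by move=> x _; rewrite derive1E; case: (dF x).
have F0 : (\int[mu]_x g n x @[n --> \oo] --> (0 : \bar R))%E.
  rewrite (funext Ig); apply: cvg_EFin; first exact: nearW.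
  apply: (@squeeze_cvgr _ _ _ _ (fun n => - (2 * K) * harmonic n)
                               (fun n => (2 * K) * harmonic n)).
  - apply: nearW => n.
    rewrite /= mulNr -ler_norml /harmonic/= ler_pdivlMr ?ltr0Sn//.
    have := FK (m + n.+1%:R); have := FK (m - n.+1%:R).
    rewrite (_ : m - n.+1%:R - m = - n.+1%:R); last lra.
    rewrite (_ : m + n.+1%:R - m = n.+1%:R); last lra.
    rewrite normrN ger0_norm// => h1 h2.
    apply: (@le_trans _ _
      ((`|F (m + n.+1%:R)| + `|F (m - n.+1%:R)|) * n.+1%:R)).
      by rewrite ler_wpM2r// ler_normB.
    nra.
  - rewrite -[X in _ --> X](mulr0 (- (2 * K))).
    by apply: cvgMr; exact: cvg_harmonic.
  - rewrite -[X in _ --> X](mulr0 (2 * K)).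
    by apply: cvgMr; exact: cvg_harmonic.
have := cvg_unique _ cvgi F0; rewrite /Rintegral => -> //.
Qed.

Lemma is_derive_normal_pdf (m s x : R) : s != 0 ->
  is_derive x (1 : R) (normal_pdf m s) (- (x - m) / s ^+ 2 * normal_pdf m s x).
Proof.
move=> s0.
have d1 : is_derive x (1 : R) (fun x : R => - (x - m) ^+ 2 / (s ^+ 2 *+ 2))
                      (- (x - m) / s ^+ 2).
  have -> : (fun x : R => - (x - m) ^+ 2 / (s ^+ 2 *+ 2)) =
      (- (s ^+ 2 *+ 2)^-1) *: ((id - cst m) ^+ 2).
    by apply/funext => y; rewrite !fctE /= /GRing.scale/=; ring.
  apply: is_derive_eq; rewrite !fctE /GRing.scale/=; field.
  by [].
rewrite normal_pdfE//.
have -> : (fun x0 => normal_peak s * normal_fun m s x0) =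
   normal_peak s *: (expR \o (fun x : R => - (x - m) ^+ 2 / (s ^+ 2 *+ 2))).
  by apply/funext => y.
apply: is_derive_eq; rewrite /GRing.scale/=.
by rewrite /normal_fun; ring.
Qed.

Lemma is_derive_cos_affine (t c x : R) :
  is_derive x (1 : R) (fun x => cos (t * x + c)) (- t * sin (t * x + c)).
Proof.
have -> : (fun x => cos (t * x + c)) = cos \o (t *: id + cst c).
  by apply/funext => y.
by apply: is_derive_eq; rewrite !fctE /GRing.scale/=; ring.
Qed.

Lemma is_derive_sin_affine (t c x : R) :
  is_derive x (1 : R) (fun x => sin (t * x + c)) (t * cos (t * x + c)).
Proof.
have -> : (fun x => sin (t * x + c)) = sin \o (t *: id + cst c).
  by apply/funext => y.
by apply: is_derive_eq; rewrite !fctE /GRing.scale/=; ring.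
Qed.

(** A normal density of twice the variance absorbs a linear factor: with
    y = x - m, one has |y| <= s (1 + y^2 / (4 s^2)) <= s exp (y^2 / (4 s^2)).
    Hence first moments are integrable and the density decays at least as fast
    as 1 / |y|. *)
Lemma normal_pdf_moment_ub (m s x : R) : 0 < s ->
  `|x - m| * normal_pdf m s x <=
  s * normal_peak s / normal_peak (Num.sqrt 2 * s) *
  normal_pdf m (Num.sqrt 2 * s) x.
Proof.
move=> s0.
have s20 : 0 < Num.sqrt 2 * s by rewrite mulr_gt0// sqrtr_gt0.
rewrite !normal_pdfE ?gt_eqF//.
rewrite [leRHS]mulrA mulfVK ?gt_eqF ?normal_peak_gt0 ?gt_eqF//.
rewrite mulrCA -mulrA [leRHS]mulrCA ler_wpM2l ?normal_peak_ge0//.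
rewrite /normal_fun exprMn sqr_sqrtr//.
set y := x - m.
have -> : - y ^+ 2 / (s ^+ 2 *+ 2) =
    - y ^+ 2 / ((2 * s ^+ 2) *+ 2) - y ^+ 2 / (4 * s ^+ 2).
  by field; rewrite gt_eqF.
rewrite expRD expRN mulrA ler_pdivrMr ?expR_gt0// [leRHS]mulrAC.
rewrite ler_wpM2r ?expR_ge0//.
apply: (@le_trans _ _ (s * (1 + y ^+ 2 / (4 * s ^+ 2)))); last first.
  by rewrite ler_wpM2l ?(ltW s0)// expR_ge1Dx.
have := sqr_ge0 (`|y| - 2 * s); rewrite sqrrB real_normK ?num_real// => H.
rewrite (_ : s * _ = s + y ^+ 2 / (4 * s)); last by field; rewrite gt_eqF.
rewrite -lerBlDl ler_pdivlMr ?mulr_gt0//; nra.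
Qed.

Lemma integrable_bounded_normal_pdf (m s : R) (f : R -> R) :
  measurable_fun [set: R] f -> (forall x, `|f x| <= 1) ->
  mu.-integrable [set: R] (fun x => (f x * normal_pdf m s x)%:E).
Proof.
move=> mf f1; apply: le_integrable (integrable_normal_pdf m s) => //.
  by apply/measurable_EFinP/measurable_funM => //; exact: measurable_normal_pdf.
move=> x _ /=; rewrite lee_fin normrM.
by rewrite -[leRHS]mul1r ler_wpM2r.
Qed.

Lemma integrable_moment_normal_pdf (m s : R) (f : R -> R) : 0 < s ->
  measurable_fun [set: R] f -> (forall x, `|f x| <= `|x - m|) ->
  mu.-integrable [set: R] (fun x => (f x * normal_pdf m s x)%:E).
Proof.
move=> s0 mf f1.
have := integrable_normal_pdf m (Num.sqrt 2 * s).
move/(integrableZl measurableT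
  (s * normal_peak s / normal_peak (Num.sqrt 2 * s))).
apply: le_integrable => //.
  by apply/measurable_EFinP/measurable_funM => //; exact: measurable_normal_pdf.
move=> x _ /=; rewrite lee_fin !normrM.
rewrite (@ger0_norm _ (normal_pdf _ _ _)) ?normal_pdf_ge0//.
apply: (@le_trans _ _ (`|x - m| * normal_pdf m s x)).
  by rewrite ler_wpM2r// normal_pdf_ge0.
apply: (le_trans (normal_pdf_moment_ub _ _ s0)).
by rewrite -!normrM ler_norm.
Qed.

Lemma continuous_cos_affine (t c : R) : continuous (fun x : R => cos (t * x + c)).
Proof.
move=> x; apply/differentiable_continuous/derivable1_diffP.
by case: (is_derive_cos_affine t c x).
Qed.

Lemma continuous_sin_affine (t c : R) : continuous (fun x : R => sin (t * x + c)).
Proof.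
move=> x; apply/differentiable_continuous/derivable1_diffP.
by case: (is_derive_sin_affine t c x).
Qed.

Lemma measurable_cos_affine (t c : R) :
  measurable_fun [set: R] (fun x => cos (t * x + c)).
Proof. apply: continuous_measurable_fun; exact: continuous_cos_affine. Qed.

Lemma measurable_sin_affine (t c : R) :
  measurable_fun [set: R] (fun x => sin (t * x + c)).
Proof. apply: continuous_measurable_fun; exact: continuous_sin_affine. Qed.

Lemma normal_pdf_moment_le (m s : R) : 0 < s ->
  {K : R | forall x, `|x - m| * normal_pdf m s x <= K}.
Proof.
move=> s0.
exists (s * normal_peak s / normal_peak (Num.sqrt 2 * s) *
  normal_peak (Num.sqrt 2 * s)).
move=> x; apply: (le_trans (normal_pdf_moment_ub _ _ s0)).
rewrite ler_wpM2l ?normal_pdf_ub//; last first.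
  by rewrite gt_eqF// mulr_gt0// sqrtr_gt0.
rewrite mulr_ge0 ?invr_ge0 ?normal_peak_ge0//.
by rewrite mulr_ge0 ?normal_peak_ge0 ?ltW.
Qed.

(** Stein's identity for a sine: the derivative of sin (t x + c) times the
    density has integral zero, and the logarithmic derivative of the density is
    - (x - m) / s^2. *)
Lemma normal_stein_sin (m s t c : R) : 0 < s ->
  \int[mu]_x (- (x - m) * sin (t * x + c) * normal_pdf m s x) =
  - (s ^+ 2 * t) * \int[mu]_x (cos (t * x + c) * normal_pdf m s x).
Proof.
move=> s0.
have [K FK] := normal_pdf_moment_le m s0.
have i1 : mu.-integrable [set: R]
    (fun x => (cos (t * x + c) * normal_pdf m s x)%:E).
  apply: integrable_bounded_normal_pdf; first exact: measurable_cos_affine.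
  by move=> x; rewrite ler_norml cos_geN1 cos_le1.
have i2 : mu.-integrable [set: R]
    (fun x => (- (x - m) * sin (t * x + c) * normal_pdf m s x)%:E).
  apply: integrable_moment_normal_pdf => //.
    apply: measurable_funM; last exact: measurable_sin_affine.
    apply: continuous_measurable_fun => x; apply: cvgN.
    by apply: cvgB => //; exact: cvg_cst.
  by move=> x; rewrite normrM normrN ler_piMr// ler_norml sin_geN1 sin_le1.
have i1' := integrableZl measurableT t i1.
have i2' := integrableZl measurableT (s ^- 2) i2.
pose F x := sin (t * x + c) * normal_pdf m s x.
have dF (x : R) : is_derive x (1 : R) F
    (t * (cos (t * x + c) * normal_pdf m s x)
      + s ^- 2 * (- (x - m) * sin (t * x + c) * normal_pdf m s x)).
  have H := is_deriveM (is_derive_sin_affine t c x)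
    (@is_derive_normal_pdf m s x (lt0r_neq0 s0)).
  by apply: (@is_derive_eq _ _ _ _ _ _ _ _ H); rewrite /GRing.scale/=; ring.
have cs : s != 0 by rewrite gt_eqF.
have := integral_derive_eq0 dF _ _ (m := m) (K := K).
rewrite RintegralD//= RintegralZl//= RintegralZl//= => H.
have key (a b : R) : t * a + s ^- 2 * b = 0 -> b = - (s ^+ 2 * t) * a.
  move=> /(congr1 ( *%R (s ^+ 2))).
  by rewrite mulr0 mulrDr mulVKf ?expf_neq0// => e; lra.
apply: key; apply: H.
- move=> x; apply: cvgD; apply: cvgM; try exact: cvg_cst; apply: cvgM.
  + exact: continuous_cos_affine.
  + exact: continuous_normal_pdf.
  + apply: cvgM; last exact: continuous_sin_affine.
    by apply: cvgN; apply: cvgB => //; exact: cvg_cst.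
  + exact: continuous_normal_pdf.
- rewrite [X in integrable _ _ X](_ : _ = fun x =>
    (t%:E * (cos (t * x + c) * normal_pdf m s x)%:E +
    (s ^- 2)%:E * (- (x - m) * sin (t * x + c) * normal_pdf m s x)%:E)%E) //.
  exact: integrableD.
- move=> x; apply: le_trans (FK x); rewrite ler_wpM2l// normrM.
  rewrite (@ger0_norm _ (normal_pdf _ _ _)) ?normal_pdf_ge0//.
  by rewrite ler_piMl ?normal_pdf_ge0// ler_norml sin_geN1 sin_le1.
Qed.

(** As a function of t the integral G satisfies G' = - s^2 t G, by
    differentiation under the integral and Stein's identity; so G times
    exp (s^2 t^2 / 2) is constant. *)
Lemma normal_cos_phase (m s t c : R) : 0 < s ->
  \int[mu]_x (cos (t * (x - m) + c) * normal_pdf m s x) =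
  expR (- (s * t) ^+ 2 / 2) * cos c.
Proof.
move=> s0.
pose f (t x : R) := cos (t * (x - m) + c) * normal_pdf m s x.
pose G t := \int[mu]_x f t x.
have fE t' x : f t' x = cos (t' * x + (c - t' * m)) * normal_pdf m s x.
  by congr (cos _ * _); ring.
have fE' t' x : f t' x = normal_pdf m s x *: cos ((x - m) * t' + c).
  by rewrite /f mulrC (mulrC t').
have intf t' : mu.-integrable [set: R] (EFin \o f t').
  rewrite /comp; under eq_fun do rewrite fE.
  apply: integrable_bounded_normal_pdf; first exact: measurable_cos_affine.
  by move=> x; rewrite ler_norml cos_geN1 cos_le1.
have df t' x : is_derive t' (1 : R) (f ^~ x)
    (- (x - m) * sin (t' * x + (c - t' * m)) * normal_pdf m s x).
  have -> : f ^~ x = normal_pdf m s x *: (fun t => cos ((x - m) * t + c)).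
    by apply/funext => u; rewrite fE'.
  have H := is_deriveZ (normal_pdf m s x) (is_derive_cos_affine (x - m) c t').
  apply: (@is_derive_eq _ _ _ _ _ _ _ _ H); rewrite /GRing.scale/=.
  rewrite (_ : (x - m) * t' + c = t' * x + (c - t' * m)); last ring.
  ring.
have dfE t' x : partial1of2 f t' x =
    - (x - m) * sin (t' * x + (c - t' * m)) * normal_pdf m s x.
  by rewrite partial1of2E; case: (df t' x).
have dG (t' : R) : is_derive t' (1 : R) G (- (s ^+ 2 * t') * G t').
  have I : `]t' - 1, t' + 1[%classic t'.
    by rewrite /= in_itv/=; apply/andP; split; lra.
  have ig : mu.-integrable [set: R]
      (EFin \o (fun x => `|x - m| * normal_pdf m s x)).
    apply: integrable_moment_normal_pdf => //; last by move=> x; rewrite normr_id.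
    apply: continuous_measurable_fun => x.
    by apply: cvg_norm; apply: cvgB => //; exact: cvg_cst.
  have ub (u x : R) : `]t' - 1, t' + 1[%classic u -> [set: R] x ->
      `|partial1of2 f u x| <= `|x - m| * normal_pdf m s x.
    move=> _ _; rewrite dfE !normrM normrN.
    rewrite (@ger0_norm _ (normal_pdf _ _ _)) ?normal_pdf_ge0//.
    rewrite ler_wpM2r ?normal_pdf_ge0// ler_piMr//.
    by rewrite ler_norml sin_geN1 sin_le1.
  have g0 x : 0 <= `|x - m| * normal_pdf m s x.
    by rewrite mulr_ge0 ?normal_pdf_ge0.
  have D u x : `]t' - 1, t' + 1[%classic u -> [set: R] x ->
      derivable (f ^~ x) u 1.
    by move=> _ _; case: (df u x).
  have i u : `]t' - 1, t' + 1[%classic u ->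
    mu.-integrable [set: R] (EFin \o f u) by [].
  apply: DeriveDef.
    exact: (derivable_under_integral measurableT I i D g0 ig ub).
  rewrite -derive1E (differentiation_under_integral measurableT I i D g0 ig ub).
  under eq_Rintegral do rewrite dfE.
  rewrite normal_stein_sin//; congr (_ * _).
  by apply: eq_Rintegral => x _; rewrite fE.
pose E (t : R) := expR (s ^+ 2 / 2 * t ^+ 2).
have dE (t' : R) : is_derive t' (1 : R) E (s ^+ 2 * t' * E t').
  have -> : E = expR \o ((s ^+ 2 / 2) *: (id ^+ 2)).
    by apply/funext => u; rewrite /E !fctE.
  by apply: is_derive_eq; rewrite !fctE /E /GRing.scale/=; field.
have dGE (t' : R) : is_derive t' (1 : R) (G * E) 0.
  have H := is_deriveM (dG t') (dE t').
  apply: (@is_derive_eq _ _ _ _ _ _ _ _ H); rewrite /GRing.scale/=; ring.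
have := is_derive_0_is_cst t 0 dGE.
rewrite !fctE /E expr0n/= mulr0 expR0 mulr1.
have -> : G 0 = cos c.
  rewrite /G /f; under eq_Rintegral do rewrite mul0r add0r.
  rewrite RintegralZl//; last exact: integrable_normal_pdf.
  by rewrite /Rintegral integral_normal_pdf mulr1.
move=> <-; rewrite -/(G t) mulrCA -expRD.
rewrite (_ : _ + _ = 0) ?expR0 ?mulr1//; ring.
Qed.

(** The shape met when the square is completed in one coordinate of a quadratic
    form: q is a pivot, and m and c collect the other coordinates. *)
Lemma integral_gauss_wave (q m t a b c : R) : 0 < q ->
  (\int[mu]_x
     ((a + b * cos (t * x + c)) * expR (- (q * (x + m) ^+ 2) / 2))%:E)%E =
  (Num.sqrt (2 * pi / q) *
   (a + b * expR (- (t ^+ 2 / q) / 2) * cos (c - t * m)))%:E.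
Proof.
move=> q0; pose s := (Num.sqrt q)^-1.
have s0 : 0 < s by rewrite invr_gt0 sqrtr_gt0.
have ss : s ^+ 2 = q^-1 by rewrite exprVn sqr_sqrtr ?ltW.
have pk : Num.sqrt (2 * pi / q) = (normal_peak s)^-1.
  by rewrite /normal_peak invrK ss; congr Num.sqrt; field; rewrite gt_eqF.
have pk0 : normal_peak s != 0 by rewrite gt_eqF ?normal_peak_gt0 ?gt_eqF.
have eE x : (a + b * cos (t * x + c)) * expR (- (q * (x + m) ^+ 2) / 2) =
    (normal_peak s)^-1 * (a * (1 * normal_pdf (- m) s x)
     + b * (cos (t * x + c) * normal_pdf (- m) s x)).
  rewrite normal_pdfE ?gt_eqF// /normal_fun ss opprK.
  rewrite (_ : - (q * (x + m) ^+ 2) / 2 = - (x + m) ^+ 2 / (q^-1 *+ 2)).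
    by field.
  by field; rewrite gt_eqF//= invr_neq0 ?gt_eqF.
have i1 : mu.-integrable [set: R] (fun x => (1 * normal_pdf (- m) s x)%:E).
  by apply: (@integrable_bounded_normal_pdf _ _ (cst 1)) => // x; rewrite normr1.
have i2 : mu.-integrable [set: R]
    (fun x => (cos (t * x + c) * normal_pdf (- m) s x)%:E).
  apply: integrable_bounded_normal_pdf; first exact: measurable_cos_affine.
  by move=> x; rewrite ler_norml cos_geN1 cos_le1.
have i1' := integrableZl measurableT a i1.
have i2' := integrableZl measurableT b i2.
have i3 : mu.-integrable [set: R] (fun x => (a * (1 * normal_pdf (- m) s x)
     + b * (cos (t * x + c) * normal_pdf (- m) s x))%:E).
  exact: integrableD i1' i2'.
have i4 : mu.-integrable [set: R] (fun x =>
    ((a + b * cos (t * x + c)) * expR (- (q * (x + m) ^+ 2) / 2))%:E).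
  under eq_fun do rewrite eE.
  exact: integrableZl i3.
rewrite -(fineK (integrable_fin_num measurableT i4)); congr EFin.
rewrite -/(Rintegral _ _ _).
under eq_Rintegral do rewrite eE.
rewrite RintegralZl// RintegralD// RintegralZl// RintegralZl// pk.
congr (_ * (_ + _)).
  under eq_Rintegral do rewrite mul1r.
  by rewrite /Rintegral integral_normal_pdf mulr1.
rewrite -mulrA; congr (_ * _).
under eq_Rintegral => x _.
  rewrite (_ : t * x + c = t * (x - (- m)) + (c - t * m)); last by ring.
  over.
rewrite normal_cos_phase// exprMn ss; congr (expR _ * _).
by field; rewrite gt_eqF.
Qed.

End gauss_line.

(** * Quadratic forms and Schur complements *)

Section quadratic_forms.
Context {R : realType}.

Lemma cV_consE0 n (p : R * 'cV[R]_n) j : cV_cons p ord0 j = p.1.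
Proof.
transitivity ((const_mx p.1 : 'cV[R]_1) ord0 j); last by rewrite mxE.
rewrite -(col_mxEu (const_mx p.1 : 'cV[R]_1) p.2).
by congr (col_mx _ _ _ _); exact: val_inj.
Qed.

Lemma cV_consES n (p : R * 'cV[R]_n) i j : cV_cons p (lift ord0 i) j = p.2 i j.
Proof.
rewrite -(col_mxEd (const_mx p.1 : 'cV[R]_1) p.2).
by congr (col_mx _ _ _ _); exact: val_inj.
Qed.

Lemma dotvE n (x y : 'cV[R]_n) : dotv x y = \sum_i x i ord0 * y i ord0.
Proof. by rewrite /dotv mxE; apply: eq_bigr => i _; rewrite mxE. Qed.

Lemma dotvC n (x y : 'cV[R]_n) : dotv x y = dotv y x.
Proof. by rewrite !dotvE; apply: eq_bigr => i _; rewrite mulrC. Qed.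

Lemma dotvDr n (x y z : 'cV[R]_n) : dotv x (y + z) = dotv x y + dotv x z.
Proof. by rewrite /dotv mulmxDr mxE. Qed.

Lemma dotvZr n (a : R) (x y : 'cV[R]_n) : dotv x (a *: y) = a * dotv x y.
Proof. by rewrite /dotv -scalemxAr mxE. Qed.

Lemma dotvDl n (x y z : 'cV[R]_n) : dotv (x + y) z = dotv x z + dotv y z.
Proof. by rewrite !(dotvC _ z) dotvDr. Qed.

Lemma dotvZl n (a : R) (x y : 'cV[R]_n) : dotv (a *: x) y = a * dotv x y.
Proof. by rewrite !(dotvC _ y) dotvZr. Qed.

Lemma dotv0l n (x : 'cV[R]_n) : dotv 0 x = 0.
Proof. by rewrite /dotv trmx0 mul0mx mxE. Qed.

Lemma dotv0r n (x : 'cV[R]_n) : dotv x 0 = 0.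
Proof. by rewrite dotvC dotv0l. Qed.

Lemma dotv_col_mx m n (x1 y1 : 'cV[R]_m) (x2 y2 : 'cV[R]_n) :
  dotv (col_mx x1 x2) (col_mx y1 y2) = dotv x1 y1 + dotv x2 y2.
Proof. by rewrite /dotv tr_col_mx mul_row_col mxE. Qed.

Lemma dotv_cV_cons n (x y : R) (v w : 'cV[R]_n) :
  dotv (cV_cons (x, v)) (cV_cons (y, w)) = x * y + dotv v w.
Proof.
rewrite !dotvE big_ord_recl !cV_consE0; congr (_ + _).
by apply: eq_bigr => i _; rewrite !cV_consES.
Qed.

Definition head_col n (Q : 'M[R]_n.+1) : 'cV[R]_n :=
  \col_i Q (lift ord0 i) ord0.

Definition tail_mx n (Q : 'M[R]_n.+1) : 'M[R]_n :=
  \matrix_(i, j) Q (lift ord0 i) (lift ord0 j).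

(** The form left on the other coordinates once the square is completed in the
    first one; see quad_cV_cons. *)
Definition schur n (Q : 'M[R]_n.+1) : 'M[R]_n :=
  tail_mx Q - (Q ord0 ord0)^-1 *: (head_col Q *m (head_col Q)^T).

Lemma mulmx_cV_cons n (Q : 'M[R]_n.+1) x v : Q^T = Q ->
  Q *m cV_cons (x, v) =
  cV_cons (Q ord0 ord0 * x + dotv (head_col Q) v,
           x *: head_col Q + tail_mx Q *m v).
Proof.
move=> sQ; apply/matrixP => i j; rewrite ord1 mxE big_ord_recl cV_consE0.
case: (unliftP ord0 i) => [k|] ->.
  rewrite cV_consES !mxE /=; congr (_ + _); first exact: mulrC.
  by apply: eq_bigr => l _; rewrite cV_consES mxE.
rewrite cV_consE0 dotvE /=; congr (_ + _); apply: eq_bigr => l _.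
by rewrite cV_consES mxE -{1}sQ mxE.
Qed.

Lemma dotv_schur n (Q : 'M[R]_n.+1) u v :
  dotv u (schur Q *m v) = dotv u (tail_mx Q *m v)
    - (Q ord0 ord0)^-1 * (dotv (head_col Q) u * dotv (head_col Q) v).
Proof.
rewrite /schur mulmxBl -scalemxAl -scaleN1r dotvDr !dotvZr mulN1r -mulmxA.
congr (_ - _ * _).
rewrite (dotvC _ u).
have -> : (head_col Q)^T *m v = (dotv (head_col Q) v)%:M.
  by rewrite [LHS]mx11_scalar.
by rewrite mul_mx_scalar dotvZr mulrC.
Qed.

Lemma symmetric_schur n (Q : 'M[R]_n.+1) : Q^T = Q -> (schur Q)^T = schur Q.
Proof.
move=> sQ; rewrite /schur linearB linearZ /= trmx_mul trmxK; congr (_ - _).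
by apply/matrixP => i j; rewrite !mxE -{1}sQ mxE.
Qed.

Lemma cV_consP n (x : 'cV[R]_n.+1) : exists y v, x = cV_cons (y, v).
Proof.
exists (x ord0 ord0), (\col_i x (lift ord0 i) ord0).
apply/matrixP => i j; rewrite ord1; case: (unliftP ord0 i) => [k|] ->.
  by rewrite cV_consES mxE.
by rewrite cV_consE0.
Qed.

Lemma posdef_pivot_gt0 n (Q : 'M[R]_n.+1) :
  symmetric_posdef Q -> 0 < Q ord0 ord0.
Proof.
move=> [sQ pQ]; have := pQ (cV_cons (1, 0)).
rewrite mulmx_cV_cons// dotv_cV_cons dotv0l dotv0r mulr1 addr0 addr0 mul1r; apply.
apply/eqP => /matrixP /(_ ord0 ord0); rewrite cV_consE0 mxE => /eqP.
by rewrite oner_eq0.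
Qed.

Lemma quad_cV_cons n (Q : 'M[R]_n.+1) x v : symmetric_posdef Q ->
  dotv (cV_cons (x, v)) (Q *m cV_cons (x, v)) =
  Q ord0 ord0 * (x + (Q ord0 ord0)^-1 * dotv (head_col Q) v) ^+ 2
  + dotv v (schur Q *m v).
Proof.
move=> pQ; have q0 := posdef_pivot_gt0 pQ; case: pQ => sQ _.
rewrite mulmx_cV_cons// dotv_cV_cons dotv_schur dotvDr dotvZr.
rewrite (dotvC v (head_col Q)).
by field; rewrite gt_eqF.
Qed.

(** The value of the form at v is that of Q at (x, v), where x makes the
    completed square vanish. *)
Lemma posdef_schur n (Q : 'M[R]_n.+1) :
  symmetric_posdef Q -> symmetric_posdef (schur Q).
Proof.
move=> pQ; have q0 := posdef_pivot_gt0 pQ; case: (pQ) => sQ pos.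
split; first exact: symmetric_schur.
move=> v v0.
have := pos (cV_cons (- ((Q ord0 ord0)^-1 * dotv (head_col Q) v), v)).
rewrite quad_cV_cons// addNr expr0n/= mulr0 add0r; apply.
apply: contra_neq v0 => /matrixP e; apply/matrixP => i j.
by have := e (lift ord0 i) j; rewrite cV_consES !mxE.
Qed.

(** One step of column elimination: Q becomes block lower triangular after
    multiplication by a unipotent matrix. *)
Lemma det_schur n (Q : 'M[R]_n.+1) : symmetric_posdef Q ->
  \det Q = Q ord0 ord0 * \det (schur Q).
Proof.
move=> pQ; have q0 := posdef_pivot_gt0 pQ; case: (pQ) => sQ pos.
pose q := Q ord0 ord0; pose c := head_col Q.
have QE : Q = block_mx (q%:M : 'M[R]_1) (c^T) c (tail_mx Q) :> 'M[R]_(1 + n).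
  apply/matrixP => i j.
  case: (split_ordP (i : 'I_(1 + n))) => k ->;
    case: (split_ordP (j : 'I_(1 + n))) => l ->.
  - rewrite block_mxEul mxE !ord1 eqxx mulr1n; congr (Q _ _); exact: val_inj.
  - rewrite block_mxEur !mxE -{1}sQ mxE !ord1; congr (Q _ _); exact: val_inj.
  - rewrite block_mxEdl !mxE !ord1; congr (Q _ _); exact: val_inj.
  - rewrite block_mxEdr !mxE; congr (Q _ _); exact: val_inj.
pose U : 'M[R]_(1 + n) := block_mx 1%:M (- q^-1 *: c^T) 0 1%:M.
have : \det ((Q : 'M[R]_(1 + n)) *m U) = q * \det (schur Q).
  rewrite [X in \det (X *m _)]QE /U mulmx_block !mulmx1 !mulmx0 !addr0.
  rewrite mul_scalar_mx scalerA.
  rewrite mulrN mulfV ?gt_eqF// scaleN1r addNr.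
  rewrite det_lblock det_scalar1; congr (_ * \det _).
    by rewrite /schur -scalemxAr scaleNr addrC.
by rewrite det_mulmx det_ublock !det1 !mulr1.
Qed.

Lemma posdef_det_gt0 n (Q : 'M[R]_n) : symmetric_posdef Q -> 0 < \det Q.
Proof.
elim: n Q => [|n IH] Q pQ; first by rewrite det_mx00.
rewrite det_schur// mulr_gt0 ?posdef_pivot_gt0//.
exact/IH/posdef_schur.
Qed.

Lemma posdef_unitmx n (Q : 'M[R]_n) : symmetric_posdef Q -> Q \in unitmx.
Proof. by move=> /posdef_det_gt0 d; rewrite unitmxE unitfE gt_eqF. Qed.

Lemma posdef_invmx n (Q : 'M[R]_n) :
  symmetric_posdef Q -> symmetric_posdef (invmx Q).
Proof.
move=> pQ; have uQ := posdef_unitmx pQ; case: pQ => sQ pQ.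
split; first by rewrite trmx_inv sQ.
move=> x x0; have := pQ (invmx Q *m x); rewrite mulKVmx// dotvC; apply.
by apply: contra_neq x0 => e; rewrite -(mulKVmx uQ x) e mulmx0.
Qed.

Section block.
Variables (m n : nat) (Sigma : 'M[R]_(m + n)).
Hypothesis pS : symmetric_posdef Sigma.

Lemma posdef_ulsubmx : symmetric_posdef (ulsubmx Sigma).
Proof.
case: pS => sS pos; split; first by rewrite trmx_ulsub sS.
move=> x x0; have := pos (col_mx x 0).
rewrite -[Sigma in Sigma *m _]submxK mul_block_col !mulmx0 !addr0 dotv_col_mx.
rewrite dotv0l addr0.
apply; apply: contra_neq x0 => e.
by rewrite -[x](col_mxKu x (0 : 'cV[R]_n)) e linear0.
Qed.

Lemma posdef_drsubmx : symmetric_posdef (drsubmx Sigma).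
Proof.
case: pS => sS pos; split; first by rewrite trmx_drsub sS.
move=> x x0; have := pos (col_mx 0 x).
rewrite -[Sigma in Sigma *m _]submxK mul_block_col !mulmx0 !add0r dotv_col_mx.
rewrite dotv0l add0r.
apply; apply: contra_neq x0 => e.
by rewrite -[x](col_mxKd (0 : 'cV[R]_m) x) e linear0.
Qed.

Hypothesis S12 : ursubmx Sigma = 0.

Lemma block_diagE : Sigma = block_mx (ulsubmx Sigma) 0 0 (drsubmx Sigma).
Proof.
have S21 : dlsubmx Sigma = 0.
  by case: pS => sS _; rewrite -[Sigma]sS -trmx_ursub S12 trmx0.
by rewrite -[LHS]submxK S12 S21.
Qed.

Lemma invmx_block_diag :
  invmx Sigma = block_mx (invmx (ulsubmx Sigma)) 0 0 (invmx (drsubmx Sigma)).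
Proof.
have u1 := posdef_unitmx posdef_ulsubmx; have u2 := posdef_unitmx posdef_drsubmx.
have uS := posdef_unitmx pS.
apply: (can_inj (mulKmx uS)); rewrite mulmxV// [X in _ = X *m _]block_diagE.
by rewrite mulmx_block !mulmx0 !mul0mx !addr0 !add0r !mulmxV// -scalar_mx_block.
Qed.

Lemma det_block_diag : \det Sigma = \det (ulsubmx Sigma) * \det (drsubmx Sigma).
Proof. by rewrite [in LHS]block_diagE det_lblock. Qed.

(** This is how uncorrelated blocks of a normal vector become independent. *)
Lemma mvnormal_pdf_block_diag (x1 : 'cV[R]_m) (x2 : 'cV[R]_n) :
  mvnormal_pdf 0 Sigma (col_mx x1 x2) =
  mvnormal_pdf 0 (ulsubmx Sigma) x1 * mvnormal_pdf 0 (drsubmx Sigma) x2.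
Proof.
rewrite /mvnormal_pdf !subr0 det_block_diag invmx_block_diag mul_block_col.
rewrite !mul0mx !addr0 !add0r dotv_col_mx exprD.
rewrite [(dotv _ _ + _) / 2]mulrDl opprD expRD [RHS]mulrACA; congr (_ * _).
rewrite -invfM -sqrtrM; last first.
  rewrite mulr_ge0 ?exprn_ge0 ?mulr_ge0 ?pi_ge0//.
  exact/ltW/posdef_det_gt0/posdef_ulsubmx.
by congr (Num.sqrt _)^-1; ring.
Qed.
End block.

End quadratic_forms.

(** * Lebesgue measure on column vectors *)

Section lebesgue_column_vectors.
Context {R : realType}.
Local Notation mu := (@lebesgue_measure R).

Lemma ge0_integral_lebesgue_cVS n (f : 'cV[R]_n.+1 -> \bar R) :
  measurable_fun setT f -> (forall x, 0 <= f x)%E ->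
  (\int[lebesgue_cV R n.+1]_v f v =
   \int[mu]_x \int[lebesgue_cV R n]_v f (cV_cons (x, v)))%E.
Proof.
move=> mf f0.
transitivity (\int[pushforward (mu \x lebesgue_cV R n) (@cV_cons R n)]_v f v)%E.
  by [].
rewrite ge0_integral_pushforward//; last exact: measurable_cV_cons.
rewrite preimage_setT fubini_tonelli1//=.
by apply: measurableT_comp => //; exact: measurable_cV_cons.
Qed.

Lemma measurable_cV_integral n (f : 'cV[R]_n.+1 -> \bar R) :
  measurable_fun setT f -> (forall x, 0 <= f x)%E ->
  measurable_fun [set: measurableTypeR R]
    (fun x => \int[lebesgue_cV R n]_v f (cV_cons (x, v)))%E.
Proof.
move=> mf f0.
apply: (@measurable_fun_fubini_tonelli_F _ _ _ _ _ (lebesgue_cV R n)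
  (f \o @cV_cons R n)) => //.
  by apply: measurableT_comp => //; exact: measurable_cV_cons.
by move=> x; exact: f0.
Qed.

Lemma measurable_col_mx m n :
  measurable_fun setT (fun p : 'cV[R]_m * 'cV[R]_n => col_mx p.1 p.2).
Proof.
apply: measurable_fun_mxP => i j.
case: (split_ordP i) => k ->.
- rewrite (_ : (fun _ => _) = (fun v : 'cV[R]_m => v k j) \o fst).
    exact: (measurableT_comp (measurable_mx_coord k j) measurable_fst).
  by apply/funext => p; rewrite col_mxEu.
- rewrite (_ : (fun _ => _) = (fun v : 'cV[R]_n => v k j) \o snd).
    exact: (measurableT_comp (measurable_mx_coord k j) measurable_snd).
  by apply/funext => p; rewrite col_mxEd.
Qed.

Lemma col_mx_cV_cons m n (x : R) (u : 'cV[R]_m) (w : 'cV[R]_n) :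
  col_mx (cV_cons (x, u)) w = cV_cons (x, col_mx u w) :> 'cV[R]_(m + n).+1.
Proof.
apply/matrixP => i j; case: (unliftP ord0 i) => [k|] ->; last first.
  rewrite [RHS]cV_consE0 (_ : ord0 = lshift n (ord0 : 'I_m.+1)); last first.
    exact: val_inj.
  by rewrite [LHS]col_mxEu cV_consE0.
rewrite [RHS]cV_consES /=; case: (split_ordP k) => l ->.
  rewrite col_mxEu (_ : lift _ _ = lshift n (lift ord0 l)); last exact: val_inj.
  by rewrite [LHS]col_mxEu cV_consES.
rewrite col_mxEd (_ : lift _ _ = rshift m.+1 l); last exact: val_inj.
by rewrite [LHS]col_mxEd.
Qed.

Lemma measurable_cV_cons_pair n (x : measurableTypeR R) :
  measurable_fun setT (fun v : 'cV[R]_n => cV_cons (x, v)).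
Proof.
have := @measurable_cV_cons R n.
move/measurableT_comp; apply; exact: measurable_pair1.
Qed.

Lemma measurable_col_mx_integral m n (f : 'cV[R]_(m + n) -> \bar R) :
  measurable_fun setT f -> (forall x, 0 <= f x)%E ->
  measurable_fun setT
    (fun u : 'cV[R]_m => \int[lebesgue_cV R n]_w f (col_mx u w))%E.
Proof.
move=> mf f0.
apply: (@measurable_fun_fubini_tonelli_F _ _ _ _ _ (lebesgue_cV R n)
  (fun p => f (col_mx p.1 p.2))) => //.
by apply: measurableT_comp => //; exact: measurable_col_mx.
Qed.

(** Since lebesgue_cV adds one coordinate at a time, on top, the induction is on
    the size of the upper block, through col_mx_cV_cons. *)
Lemma ge0_integral_lebesgue_cV_add m n (f : 'cV[R]_(m + n) -> \bar R) :
  measurable_fun setT f -> (forall x, 0 <= f x)%E ->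
  (\int[lebesgue_cV R (m + n)]_v f v =
   \int[lebesgue_cV R m]_u \int[lebesgue_cV R n]_w f (col_mx u w))%E.
Proof.
elim: m f => [|m IH] f mf f0; have mg := measurable_col_mx_integral mf f0.
  rewrite integral_dirac// diracT mul1e.
  apply: eq_integral => w _; congr f.
  apply/matrixP => i j; have -> : i = rshift 0 i by exact: val_inj.
  by rewrite col_mxEd; congr (w _ _); exact: val_inj.
rewrite (@ge0_integral_lebesgue_cVS (m + n))// ge0_integral_lebesgue_cVS//; last first.
  by move=> x; exact: integral_ge0.
apply: eq_integral => x _; rewrite IH.
- apply: eq_integral => u _; apply: eq_integral => w _; congr f.
  by rewrite col_mx_cV_cons.
- apply: measurableT_comp => //.
  exact: measurable_cV_cons_pair.
- by [].
Qed.

Lemma measurable_translation (c : R) :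
  measurable_fun [set: measurableTypeR R] (fun x => x + c : measurableTypeR R).
Proof.
have : measurable_fun [set: R] (fun x => x + c) by exact: measurable_funD.
by [].
Qed.

Lemma lebesgue_measure_translation (c : R) (A : set (measurableTypeR R)) :
  measurable A -> mu ((fun x => x + c) @^-1` A) = mu A.
Proof.
move=> mA.
pose phi : {mfun measurableTypeR R >-> measurableTypeR R} :=
  HB.pack (fun x => x + c : measurableTypeR R)
    (isMeasurableFun.Build _ _ _ _ _ (measurable_translation c)).
apply/esym; apply: (@lebesgue_measure_unique _ (pushforward mu phi)) => //.
move=> _ [[a b] _ <-] /=.
rewrite /pushforward (_ : _ @^-1` _ = `](a - c), (b - c)]%classic).
  rewrite !lebesgue_measure_itv/= !lte_fin ltrD2r -!EFinB.
  by case: ifP => // _; congr EFin; lra.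
apply/seteqP; split => x /=; rewrite !in_itv/= => /andP[? ?];
  by apply/andP; split; lra.
Qed.

Lemma ge0_integral_translation (c : R) (f : measurableTypeR R -> \bar R) :
  measurable_fun setT f -> (forall x, 0 <= f x)%E ->
  (\int[mu]_x f (x + c)%R = \int[mu]_x f x)%E.
Proof.
move=> mf f0.
pose phi : {mfun measurableTypeR R >-> measurableTypeR R} :=
  HB.pack (fun x => x + c : measurableTypeR R)
    (isMeasurableFun.Build _ _ _ _ _ (measurable_translation c)).
transitivity (\int[pushforward mu phi]_x f x)%E.
  by rewrite ge0_integral_pushforward.
apply: eq_measure_integral => A mA _.
exact: lebesgue_measure_translation.
Qed.

Lemma ge0_integral_cV_translation n (a : 'cV[R]_n) (f : 'cV[R]_n -> \bar R) :
  measurable_fun setT f -> (forall x, 0 <= f x)%E ->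
  (\int[lebesgue_cV R n]_v f (v + a)%R = \int[lebesgue_cV R n]_v f v)%E.
Proof.
elim: n a f => [|n IH] a f mf f0.
  by apply: eq_integral => v _; congr f; apply/matrixP => -[].
have mg : measurable_fun setT (fun v : 'cV[R]_n.+1 => v + a).
  apply: measurable_fun_mxP => i j; under eq_fun do rewrite mxE.
  by apply: measurable_funD => //; exact: measurable_mx_coord.
rewrite !ge0_integral_lebesgue_cVS//; last exact: measurableT_comp.
pose a1 := (cV_uncons a).1; pose a2 := (cV_uncons a).2.
have aE x v : cV_cons (x, v) + a = cV_cons (x + a1, v + a2).
  apply/matrixP => i j; rewrite mxE; case: (unliftP ord0 i) => [k|] ->.
    by rewrite !cV_consES /= !mxE; congr (_ + a _ _); exact: val_inj.
  by rewrite !cV_consE0 ord1.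
transitivity (\int[mu]_x \int[lebesgue_cV R n]_v f (cV_cons ((x + a1)%R, v)))%E.
  apply: eq_integral => x _.
  rewrite -(IH a2 (fun v => f (cV_cons ((x + a1)%R, v))))//.
    by apply: eq_integral => v _; rewrite aE.
  apply: measurableT_comp => //.
  exact: measurable_cV_cons_pair.
apply: (@ge0_integral_translation a1
  (fun x => \int[lebesgue_cV R n]_v f (cV_cons (x, v))))%E.
  exact: measurable_cV_integral.
by move=> x; exact: integral_ge0.
Qed.

End lebesgue_column_vectors.

(** * Gaussian integrals of cosine waves in several variables *)

Section gauss_cV.
Context {R : realType}.
Local Notation mu := (@lebesgue_measure R).

Lemma measurable_dotv n (t : 'cV[R]_n) : measurable_fun setT (dotv t).
Proof.
rewrite (_ : dotv t = fun x : 'cV[R]_n => \sum_i t i ord0 * x i ord0); last first.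
  by apply/funext => x; rewrite dotvE.
apply: measurable_sum => i; apply: measurable_funM => //.
exact: measurable_mx_coord.
Qed.

Lemma measurable_quad n (Q : 'M[R]_n) :
  measurable_fun setT (fun x : 'cV[R]_n => dotv x (Q *m x)).
Proof.
rewrite (_ : (fun x => _) = fun x : 'cV[R]_n =>
  \sum_i x i ord0 * dotv (row i Q)^T x); last first.
  apply/funext => x; rewrite dotvE; apply: eq_bigr => i _; congr (_ * _).
  by rewrite dotvE mxE; apply: eq_bigr => j _; rewrite !mxE.
apply: measurable_sum => i; apply: measurable_funM; last exact: measurable_dotv.
exact: measurable_mx_coord.
Qed.

Lemma measurable_cos : measurable_fun [set: R] (@cos R).
Proof. by apply: continuous_measurable_fun; exact: continuous_cos. Qed.

Lemma wave_ge0 (a b x : R) : `|b| <= a -> 0 <= a + b * cos x.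
Proof.
move=> ba; have := cos_max x; have := ler_norm (- (b * cos x)).
rewrite normrN normrM => h1 h2.
have : `|b| * `|cos x| <= a by apply: le_trans ba; rewrite ler_piMr.
lra.
Qed.

Lemma measurable_gauss_wave n (Q : 'M[R]_n) (t : 'cV[R]_n) (a b c : R) :
  measurable_fun setT (fun x =>
    ((a + b * cos (dotv t x + c)) * expR (- dotv x (Q *m x) / 2))%:E).
Proof.
apply/measurable_EFinP; apply: measurable_funM.
  apply: measurable_funD => //; apply: measurable_funM => //.
  apply: measurableT_comp; first exact: measurable_cos.
  by apply: measurable_funD => //; exact: measurable_dotv.
apply: measurableT_comp => //; apply: measurable_funM => //.
by apply: measurableT_comp => //; exact: measurable_quad.
Qed.

Lemma measurable_gauss_wave1 (a b t c q m : R) :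
  measurable_fun [set: measurableTypeR R] (fun x : R =>
    ((a + b * cos (t * x + c)) * expR (- (q * (x + m) ^+ 2) / 2))%:E).
Proof.
have : measurable_fun [set: R] (fun x : R =>
    ((a + b * cos (t * x + c)) * expR (- (q * (x + m) ^+ 2) / 2))%:E).
  apply/measurable_EFinP; apply: measurable_funM.
    apply: measurable_funD => //; apply: measurable_funM => //.
    exact: measurable_cos_affine.
  apply: measurableT_comp => //; apply: measurable_funM => //.
  apply: measurableT_comp => //; apply: measurable_funM => //.
  by apply: (measurable_funX 2); exact: measurable_funD.
by [].
Qed.

(** Induction on n.  In the coordinates (x, v), with pivot q and h the rest of
    the first column of Q, completing the square gives

      (x, v) . Q (x, v) = q (x + h . v / q)^2 + v . schur Q v,

    so integrating over x produces exp (- t0^2 / (2 q)), where t0 is the first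
    coordinate of Q u, and shifts the phase by - t0 (h . v) / q.  The frequency
    that remains on v is schur Q u', so the hypothesis on n applies to schur Q
    and the tail u' of u.  Writing the frequency as Q u keeps inverse matrices
    out of the induction. *)
Lemma integral_gauss_cV_wave n (Q : 'M[R]_n) (u : 'cV[R]_n) (a b c : R) :
  symmetric_posdef Q -> `|b| <= a ->
  (\int[lebesgue_cV R n]_x
     ((a + b * cos (dotv (Q *m u) x + c)) * expR (- dotv x (Q *m x) / 2))%:E)%E =
  (Num.sqrt ((2 * pi) ^+ n / \det Q) *
   (a + b * expR (- dotv u (Q *m u) / 2) * cos c))%:E.
Proof.
elim: n Q u b => [|n IH] Q u b pQ ba.
  rewrite integral_dirac//; last exact: measurable_gauss_wave.
  rewrite diracT mul1e /= !dotv0l dotv0r !oppr0 mul0r expR0.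
  rewrite det_mx00 expr0 divr1 sqrtr1.
  rewrite (_ : dotv u _ = 0); last by rewrite dotvE big_ord0.
  by rewrite oppr0 mul0r expR0 !mulr1 mul1r add0r.
have q0 := posdef_pivot_gt0 pQ; have pS := posdef_schur pQ.
case: (pQ) => sQ _.
have [u0 [u' ->]] := cV_consP u.
pose q := Q ord0 ord0; pose h := head_col Q.
pose t0 := q * u0 + dotv h u'.
rewrite ge0_integral_lebesgue_cVS; last 2 first.
- exact: measurable_gauss_wave.
- by move=> x; rewrite lee_fin mulr_ge0 ?expR_ge0 ?wave_ge0.
(* lebesgue_cV integrates over v first; the square is completed in x. *)
rewrite (@fubini_tonelli _ _ _ _ _ mu (lebesgue_cV R n)
  ((fun x => ((a + b * cos (dotv (Q *m cV_cons (u0, u')) x + c)) *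
              expR (- dotv x (Q *m x) / 2))%:E) \o @cV_cons R n)); last 2 first.
- apply: measurableT_comp; first exact: measurable_gauss_wave.
  exact: measurable_cV_cons.
- by move=> x /=; rewrite lee_fin mulr_ge0 ?expR_ge0 ?wave_ge0.
have ba' : `|b * expR (- (t0 ^+ 2 / q) / 2)| <= a.
  apply: le_trans ba; rewrite normrM ler_piMr// ger0_norm ?expR_ge0//.
  by rewrite -expR0 ler_expR mulNr oppr_le0 !divr_ge0 ?sqr_ge0// ltW.
have sqrt0 : 0 <= Num.sqrt (2 * pi / q) by rewrite sqrtr_ge0.
transitivity (\int[lebesgue_cV R n]_v
   ((Num.sqrt (2 * pi / q))%:E *
   ((a + (b * expR (- (t0 ^+ 2 / q) / 2)) *
         cos (dotv (schur Q *m u') v + c))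
     * expR (- dotv v (schur Q *m v) / 2))%:E))%E.
  apply: eq_integral => v _ /=.
  transitivity (\int[mu]_x ((expR (- dotv v (schur Q *m v) / 2))%:E *
     ((a + b * cos (t0 * x + (u0 * dotv h v + dotv (tail_mx Q *m u') v + c)))
       * expR (- (q * (x + q^-1 * dotv h v) ^+ 2) / 2))%:E))%E.
    apply: eq_integral => x _; rewrite quad_cV_cons// -/q -/h.
    rewrite opprD [(- _ + _) / 2]mulrDl expRD mulrA mulrC EFinM.
    congr (_ * (_ * _)%:E)%E.
    rewrite mulmx_cV_cons// dotv_cV_cons -/q -/h -/t0 dotvDl dotvZl.
    by rewrite !addrA.
  rewrite ge0_integralZl//; last 2 first.
  - exact: measurable_gauss_wave1.
  - by move=> x _; rewrite lee_fin mulr_ge0 ?expR_ge0 ?wave_ge0.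
  rewrite integral_gauss_wave// -!EFinM; congr EFin.
  rewrite mulrC -!mulrA; congr (_ * _); rewrite [in RHS]mulrDl -!mulrA.
  rewrite mulrDl -!mulrA; congr (_ + _ * (_ * (cos _ * _))).
  rewrite (dotvC (schur Q *m u')) dotv_schur (dotvC (tail_mx Q *m u')).
  rewrite -/h -/q /t0.
  by field; rewrite gt_eqF.
rewrite ge0_integralZl//; last 2 first.
- exact: measurable_gauss_wave.
- by move=> x _; rewrite lee_fin mulr_ge0 ?expR_ge0 ?wave_ge0.
rewrite IH//.
rewrite -EFinM mulrA -sqrtrM; last by rewrite divr_ge0 ?mulr_ge0 ?pi_ge0// ltW.
rewrite det_schur// -/q; congr ((Num.sqrt _ * (_ + _ * _))%:E).
  rewrite exprS; field.
  by rewrite !gt_eqF ?posdef_det_gt0.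
rewrite -mulrA -expRD; congr (_ * expR _).
rewrite quad_cV_cons// -/q -/h /t0; field.
by rewrite gt_eqF.
Qed.

End gauss_cV.

(** * Normal laws *)

Section normal_law.
Context {R : realType}.

Lemma mvnormal_pdf_ge0 n (mu x : 'cV[R]_n) (Sigma : 'M[R]_n) :
  0 <= mvnormal_pdf mu Sigma x.
Proof. by rewrite /mvnormal_pdf mulr_ge0 ?invr_ge0 ?sqrtr_ge0 ?expR_ge0. Qed.

Lemma measurable_mvnormal_pdf n (Sigma : 'M[R]_n) :
  measurable_fun setT (mvnormal_pdf 0 Sigma).
Proof.
apply: measurable_funM => //; apply: measurableT_comp => //.
apply: measurableT_comp => //; apply: measurable_funM => //.
under eq_fun do rewrite subr0.
exact: measurable_quad.
Qed.

(** Take for Q the precision matrix, the inverse of Sigma, and u = Sigma t: then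
    Q u = t, and u . Q u = t . Sigma t. *)
Lemma integral_mvnormal_wave n (Sigma : 'M[R]_n) (t : 'cV[R]_n) (a b c : R) :
  symmetric_posdef Sigma -> `|b| <= a ->
  (\int[lebesgue_cV R n]_x
     ((a + b * cos (dotv t x + c)) * mvnormal_pdf 0 Sigma x)%:E)%E =
  (a + b * expR (- dotv t (Sigma *m t) / 2) * cos c)%:E.
Proof.
move=> pS ba; have d0 := posdef_det_gt0 pS.
have uS := posdef_unitmx pS; have pQ := posdef_invmx pS.
pose k := Num.sqrt ((2 * pi) ^+ n * \det Sigma).
have k0 : 0 < k by rewrite sqrtr_gt0 mulr_gt0 ?exprn_gt0 ?mulr_gt0 ?pi_gt0.
transitivity (\int[lebesgue_cV R n]_x
  ((k^-1)%:E * ((a + b * cos (dotv (invmx Sigma *m (Sigma *m t)) x + c)) *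
    expR (- dotv x (invmx Sigma *m x) / 2))%:E))%E.
  apply: eq_integral => x _; rewrite mulKmx// /mvnormal_pdf subr0 -/k -EFinM.
  by rewrite mulrCA mulNr.
rewrite ge0_integralZl//; last 3 first.
- exact: measurable_gauss_wave.
- by move=> x _; rewrite lee_fin mulr_ge0 ?expR_ge0 ?wave_ge0.
- by rewrite lee_fin invr_ge0 ltW.
rewrite integral_gauss_cV_wave// det_inv invrK -/k -EFinM mulKf ?gt_eqF//.
by rewrite mulKmx// dotvC.
Qed.

Lemma integral_mvnormal_pdf n (Sigma : 'M[R]_n) : symmetric_posdef Sigma ->
  (\int[lebesgue_cV R n]_x (mvnormal_pdf 0 Sigma x)%:E)%E = 1%E.
Proof.
move=> pS.
transitivity (\int[lebesgue_cV R n]_x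
     ((1 + 0 * cos (dotv 0 x + 0)) * mvnormal_pdf 0 Sigma x)%:E)%E.
  by apply: eq_integral => x _; rewrite mul0r addr0 mul1r.
by rewrite integral_mvnormal_wave ?normr0// !mul0r addr0.
Qed.

Lemma measurable_usubmx m n : measurable_fun setT (@usubmx R m n 1).
Proof.
apply: measurable_fun_mxP => i j; under eq_fun do rewrite mxE.
exact: measurable_mx_coord.
Qed.

Lemma measurable_dsubmx m n : measurable_fun setT (@dsubmx R m n 1).
Proof.
apply: measurable_fun_mxP => i j; under eq_fun do rewrite mxE.
exact: measurable_mx_coord.
Qed.

Lemma measurable_preimage d d' (T : measurableType d) (T' : measurableType d')
    (f : T -> T') (A : set T') :
  measurable_fun setT f -> measurable A -> measurable (f @^-1` A).
Proof. by move=> mf mA; rewrite -[_ @^-1` _]setTI; exact: mf. Qed.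

Section marginals.
Variables (dO : measure_display) (Omega : measurableType dO).
Variables (P : probability Omega R) (d1 d2 : nat) (Sigma : 'M[R]_(d1 + d2)).
Variable X : Omega -> 'cV[R]_(d1 + d2).
Hypotheses (pS : symmetric_posdef Sigma) (S12 : ursubmx Sigma = 0).
Hypothesis (nX : mvnormal P 0 Sigma X).

(** As both factors are integrals of probability densities, taking A or B to be
    the whole space identifies them with the laws of the two blocks. *)
Lemma mvnormal_rectangle (A : set 'cV[R]_d1) (B : set 'cV[R]_d2) :
  measurable A -> measurable B ->
  (P ((fun w => usubmx (X w)) @^-1` A `&` (fun w => dsubmx (X w)) @^-1` B) =
   (\int[lebesgue_cV R d1]_(x in A) (mvnormal_pdf 0 (ulsubmx Sigma) x)%:E) *
   (\int[lebesgue_cV R d2]_(x in B) (mvnormal_pdf 0 (drsubmx Sigma) x)%:E))%E.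
Proof.
move=> mA mB.
pose D : set 'cV[R]_(d1 + d2) :=
  (@usubmx R d1 d2 1) @^-1` A `&` (@dsubmx R d1 d2 1) @^-1` B.
have mD : measurable D.
  by apply: measurableI; apply: measurable_preimage => //;
    [exact: measurable_usubmx|exact: measurable_dsubmx].
pose p1 := mvnormal_pdf 0 (ulsubmx Sigma).
pose p2 := mvnormal_pdf 0 (drsubmx Sigma).
transitivity (P (X @^-1` D)); first by [].
rewrite (nX mD) integral_mkcond ge0_integral_lebesgue_cV_add; last 2 first.
- apply/(measurable_restrictT _ mD)/measurable_funTS/measurable_EFinP.
  exact: measurable_mvnormal_pdf.
- move=> x; rewrite patchE; case: ifP => // _.
  by rewrite lee_fin mvnormal_pdf_ge0.
transitivity (\int[lebesgue_cV R d1]_u (((EFin \o p1) \_ A) u *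
   \int[lebesgue_cV R d2]_w ((EFin \o p2) \_ B) w))%E.
  apply: eq_integral => u _; rewrite -ge0_integralZl//; last 3 first.
  - apply/(measurable_restrictT _ mB)/measurable_funTS/measurable_EFinP.
    exact: measurable_mvnormal_pdf.
  - move=> x _; rewrite patchE; case: ifP => // _.
    by rewrite lee_fin mvnormal_pdf_ge0.
  - by rewrite patchE; case: ifP => // _; rewrite lee_fin mvnormal_pdf_ge0.
  apply: eq_integral => w _; rewrite !patchE.
  have -> : (col_mx u w \in D) = (u \in A) && (w \in B).
    by apply/idP/andP; rewrite !inE /D /= col_mxKu col_mxKd.
  case: (u \in A); case: (w \in B); rewrite /= ?mule0 ?mul0e//.
  by rewrite mvnormal_pdf_block_diag.
rewrite ge0_integralZr//.
- by rewrite -!integral_mkcond.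
- apply/(measurable_restrictT _ mA)/measurable_funTS/measurable_EFinP.
  exact: measurable_mvnormal_pdf.
- move=> x _; rewrite patchE; case: ifP => // _.
  by rewrite lee_fin mvnormal_pdf_ge0.
- apply: integral_ge0 => x _.
  by rewrite patchE; case: ifP => // _; rewrite lee_fin mvnormal_pdf_ge0.
Qed.

Lemma mvnormal_usubmx : mvnormal P 0 (ulsubmx Sigma) (fun w => usubmx (X w)).
Proof.
move=> B mB; have := mvnormal_rectangle mB (@measurableT _ 'cV[R]_d2).
rewrite preimage_setT setIT => ->.
by rewrite integral_mvnormal_pdf ?mule1//; exact: posdef_drsubmx.
Qed.

Lemma mvnormal_dsubmx : mvnormal P 0 (drsubmx Sigma) (fun w => dsubmx (X w)).
Proof.
move=> B mB; have := mvnormal_rectangle (@measurableT _ 'cV[R]_d1) mB.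
rewrite preimage_setT setTI => ->.
by rewrite integral_mvnormal_pdf ?mul1e//; exact: posdef_ulsubmx.
Qed.

Lemma independent2_blocks :
  independent2 P (fun w => usubmx (X w)) (fun w => dsubmx (X w)).
Proof.
move=> A B mA mB.
by rewrite mvnormal_rectangle// mvnormal_usubmx// mvnormal_dsubmx.
Qed.

End marginals.

Lemma mvnormal_translate (dO : measure_display) (Omega : measurableType dO)
    (P : probability Omega R) n (xi : 'cV[R]_n) Sigma (X : Omega -> 'cV[R]_n) :
  mvnormal P 0 Sigma X -> mvnormal P xi Sigma (fun w => xi + X w).
Proof.
move=> nX B mB.
have mg a : measurable_fun setT (fun v : 'cV[R]_n => v + a).
  apply: measurable_fun_mxP => i j; under eq_fun do rewrite mxE.
  by apply: measurable_funD => //; exact: measurable_mx_coord.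
pose B' := (fun v : 'cV[R]_n => v + xi) @^-1` B.
have mB' : measurable B' by exact: measurable_preimage.
transitivity (P (X @^-1` B')).
  by congr (P _); apply/seteqP; split => w /=; rewrite /B' /= addrC.
rewrite (nX _ mB') integral_mkcond [RHS]integral_mkcond.
pose f := ((fun x => (mvnormal_pdf xi Sigma x)%:E) \_ B).
transitivity (\int[lebesgue_cV R n]_v f (v + xi)%R)%E.
  apply: eq_integral => v _; rewrite /f !patchE /mvnormal_pdf subr0 addrK.
  by have -> : (v \in B') = (v + xi \in B) by apply/idP/idP; rewrite !inE.
apply: ge0_integral_cV_translation.
  apply/(measurable_restrictT _ mB)/measurable_funTS/measurable_EFinP.
  rewrite (_ : mvnormal_pdf xi Sigma =
               mvnormal_pdf 0 Sigma \o (fun v => v + - xi)).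
    by apply: measurableT_comp; [exact: measurable_mvnormal_pdf|exact: mg].
  by apply/funext => v; rewrite /mvnormal_pdf /= subr0.
move=> x; rewrite /f patchE; case: ifP => // _.
by rewrite lee_fin mvnormal_pdf_ge0.
Qed.

End normal_law.

(** * Independence, almost sure modifications and densities *)

Section independence.
Context {R : realType} (dO : measure_display) (Omega : measurableType dO)
  (P : probability Omega R).

Lemma independent2_sym d1 d2 (T1 : measurableType d1) (T2 : measurableType d2)
    (X : Omega -> T1) (Y : Omega -> T2) :
  independent2 P X Y -> independent2 P Y X.
Proof. by move=> XY A B mA mB; rewrite setIC XY// muleC. Qed.

Lemma independent2_comp d1 d2 d3 d4 (T1 : measurableType d1) (T2 : measurableType d2)
    (T3 : measurableType d3) (T4 : measurableType d4)
    (X : Omega -> T1) (Y : Omega -> T2) (f : T1 -> T3) (g : T2 -> T4) :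
  measurable_fun setT f -> measurable_fun setT g ->
  independent2 P X Y -> independent2 P (f \o X) (g \o Y).
Proof.
move=> mf mg XY A B mA mB.
exact: (XY (f @^-1` A) (g @^-1` B) (measurable_preimage mf mA)
  (measurable_preimage mg mB)).
Qed.

(** For fixed A, both sides of the product rule are finite measures in the event
    on (Y, Z); they agree on rectangles, which generate the product
    sigma-algebra and are stable under intersection. *)
Lemma independent2_pair d1 d2 d3 (T1 : measurableType d1) (T2 : measurableType d2)
    (T3 : measurableType d3) (X : {mfun Omega >-> T1}) (Y : {mfun Omega >-> T2})
    (Z : {mfun Omega >-> T3}) :
  (forall A B C, measurable A -> measurable B -> measurable C ->
    P (X @^-1` A `&` (Y @^-1` B `&` Z @^-1` C)) =
    (P (X @^-1` A) * P (Y @^-1` B `&` Z @^-1` C))%E) ->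
  independent2 P X (fun w => (Y w, Z w)).
Proof.
move=> rect A E mA mE.
have mYZ : measurable_fun setT (fun w => (Y w, Z w)).
  exact: measurable_fun_pair.
pose YZ : {mfun Omega >-> (T2 * T3)%type} := HB.pack (fun w => (Y w, Z w))
  (isMeasurableFun.Build _ _ _ _ _ mYZ).
have mXA : measurable (X @^-1` A) by exact: measurable_preimage.
have pA0 : 0 <= fine (P (X @^-1` A)) by rewrite fine_ge0.
have pAE : P (X @^-1` A) = (fine (P (X @^-1` A)))%:E.
  by rewrite fineK// fin_num_measure.
pose m1 := pushforward (mrestr P mXA) YZ.
pose m2 := mscale (NngNum pA0) (distribution P YZ).
pose G : set (set (T2 * T3)) := [set B `*` C | B in measurable & C in measurable].
suff : m1 E = m2 E.
  rewrite /m1 /m2 /distribution /pushforward /mrestr/= /mscale/= -pAE.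
  by rewrite setIC.
apply: (measure_unique G (fun _ => setT)) => //.
- by rewrite measurable_prod_measurableType.
- move=> _ _ [B1 mB1 [C1 mC1 <-]] [B2 mB2 [C2 mC2 <-]]; rewrite -setXI.
  exists (B1 `&` B2); first exact: measurableI.
  by exists (C1 `&` C2) => //; exact: measurableI.
- by move=> _; exists setT => //; exists setT => //; rewrite setXTT.
- by rewrite bigcup_const.
- move=> _ [B mB [C mC <-]]; rewrite /m1 /m2/= /mscale/= -pAE.
  rewrite /distribution /pushforward /mrestr/= setIC; exact: rect.
- move=> _; have mI := measurableI _ _ measurableT mXA.
  exact: (le_lt_trans (probability_le1 _ mI) (ltry _)).
Qed.

(** Independence says that the law of (X, Y) is the product of the two laws, so
    Tonelli's theorem allows integrating X first, with Y fixed. *)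
Lemma ge0_integral_independent2 d1 d2 (T1 : measurableType d1) (T2 : measurableType d2)
    (X : {mfun Omega >-> T1}) (Y : {mfun Omega >-> T2}) (f : T1 * T2 -> \bar R) :
  independent2 P X Y -> measurable_fun setT f -> (forall x, 0 <= f x)%E ->
  (\int[P]_w f (X w, Y w) = \int[P]_w \int[distribution P X]_x f (x, Y w))%E.
Proof.
move=> XY mf f0.
have mXY : measurable_fun setT (fun w => (X w, Y w)).
  exact: measurable_fun_pair.
pose XY' : {mfun Omega >-> (T1 * T2)%type} := HB.pack (fun w => (X w, Y w))
  (isMeasurableFun.Build _ _ _ _ _ mXY).
transitivity (\int[distribution P XY']_z f z)%E.
  by rewrite ge0_integral_distribution.
transitivity (\int[distribution P X \x distribution P Y]_z f z)%E.
  apply/esym/eq_measure_integral => A mA _.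
  by apply: product_measure_unique => // B C mB mC; exact: XY.
rewrite fubini_tonelli2// (@ge0_integral_distribution _ _ _ _ _ P Y)//.
  exact: measurable_fun_fubini_tonelli_G.
by move=> y; exact: integral_ge0.
Qed.

Lemma probability_eq_on (N E E' : set Omega) :
  measurable N -> measurable E -> measurable E' -> P N = 1%E ->
  E `&` N = E' `&` N -> P E = P E'.
Proof.
move=> mN mE mE' PN EE'.
have key F : measurable F -> P F = P (F `&` N).
  move=> mF; rewrite (measureDI P mF mN).
  rewrite -[RHS]add0e; congr (_ + _)%E.
  apply/eqP; rewrite eq_le measure_ge0 andbT.
  have <- : P (~` N) = 0%E by rewrite probability_setC// PN subee.
  apply: le_measure; rewrite ?inE//; [exact: measurableD|exact: measurableC].
by rewrite key// EE' -key.
Qed.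

Lemma Rintegral_eq_on (N : set Omega) (f g : Omega -> R) :
  measurable N -> P N = 1%E -> measurable_fun setT f -> measurable_fun setT g ->
  (forall w, N w -> f w = g w) ->
  \int[P]_w f w = \int[P]_w g w.
Proof.
move=> mN PN mf mg fg.
congr fine; apply: ae_eq_integral => //; try exact/measurable_EFinP.
exists (~` N); split.
- exact: measurableC.
- by rewrite [LHS]probability_setC// PN subee.
- by move=> w /= H Nw; apply: H => _; rewrite fg.
Qed.

End independence.

Section density.
Context {R : realType}.

(** The density p and the Radon-Nikodym derivative of nu have the same integral
    on every measurable set, hence agree almost everywhere. *)
Lemma ge0_integral_density d (T : measurableType d)
    (nu : {finite_measure set T -> \bar R})
    (mu : {sigma_finite_measure set T -> \bar R}) (p : T -> R) (f : T -> \bar R) :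
  measurable_fun setT p -> (forall x, 0 <= p x) ->
  (forall B, measurable B -> nu B = \int[mu]_(x in B) (p x)%:E)%E ->
  measurable_fun setT f -> (forall x, 0 <= f x)%E ->
  (\int[nu]_x f x = \int[mu]_x (f x * (p x)%:E))%E.
Proof.
move=> mp p0 nuE mf f0.
have dom : nu `<< mu.
  apply/null_content_dominatesP => A mA A0.
  rewrite (nuE _ mA); apply: null_set_integral => //.
  exact/measurable_funTS/measurable_EFinP.
have ip : mu.-integrable setT (EFin \o p).
  apply/integrableP; split; first exact/measurable_EFinP.
  under eq_integral do rewrite gee0_abs ?lee_fin//.
  rewrite -nuE//; exact: fin_num_fun_lty.
rewrite -(Radon_Nikodym_SigmaFinite.change_of_variables dom)//.
apply: ge0_ae_eq_integral => //.
- apply: emeasurable_funM => //.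
  exact: (measurable_int _ (Radon_Nikodym_SigmaFinite.f_integrable dom)).
- by apply: emeasurable_funM => //; exact/measurable_EFinP.
- by move=> x _; rewrite mule_ge0 ?Radon_Nikodym_SigmaFinite.f_ge0.
- by move=> x _; rewrite mule_ge0 ?lee_fin.
have pE : ae_eq mu setT (Radon_Nikodym_SigmaFinite.f nu mu) (EFin \o p).
  apply: integral_ae_eq => //.
  - exact: Radon_Nikodym_SigmaFinite.f_integrable.
  - exact/measurable_EFinP.
  - by move=> A _ mA; rewrite -Radon_Nikodym_SigmaFinite.f_integral// nuE.
by apply: filterS pE => x /(_ I) /= ->.
Qed.

End density.

(** * Characteristic functions *)

Section cf.
Context {R : realType} (dO : measure_display) (Omega : measurableType dO)
  (P : probability Omega R).

Lemma integrable_cos (g : Omega -> R) : measurable_fun setT g ->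
  P.-integrable setT (fun w => (cos (g w))%:E).
Proof.
move=> mg.
apply: (@measurable_bounded_integrable _ _ _ P (fun w => cos (g w))) => //.
- by rewrite (le_lt_trans (probability_le1 _ _))// ltry.
- by apply: measurableT_comp => //; exact: measurable_cos.
- exists 1; split; rewrite ?num_real// => y y1 w _ /=.
  by apply: le_trans (ltW y1); exact: cos_max.
Qed.

Lemma integral_wave (g : Omega -> R) (b : R) : measurable_fun setT g ->
  (\int[P]_w (1 + b * cos (g w))%:E)%E = (1 + b * \int[P]_w cos (g w))%:E.
Proof.
move=> mg; have ic := integrable_cos mg.
have i1 : P.-integrable setT (EFin \o cst (1 : R)).
  exact: finite_measure_integrable_cst.
rewrite (integralD measurableT i1 (integrableZl measurableT b ic)).
rewrite integralZl// [X in (X + _)%E](_ : _ = 1%E); last first.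
  apply: etrans (integral_cst P measurableT 1) _.
  by rewrite mul1e; exact: probability_setT.
by rewrite /Rintegral EFinD EFinM fineK// integrable_fin_num.
Qed.

(** With Z fixed, X is integrated against its density and Z acts as a constant
    phase. *)
Lemma Rintegral_normal_phase n (Sigma : 'M[R]_n) (X : {mfun Omega >-> 'cV[R]_n})
    (Z : {mfun Omega >-> R}) (t : 'cV[R]_n) :
  symmetric_posdef Sigma -> mvnormal P 0 Sigma X -> independent2 P X Z ->
  \int[P]_w cos (dotv t (X w) + Z w) =
  expR (- dotv t (Sigma *m t) / 2) * \int[P]_w cos (Z w).
Proof.
move=> pS nX XZ.
have mtX : measurable_fun setT (fun p : 'cV[R]_n * R => dotv t p.1 + p.2).
  apply: measurable_funD => //.
  by apply: measurableT_comp => //; exact: measurable_dotv.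
have mtXZ : measurable_fun setT (fun w => dotv t (X w) + Z w).
  apply: measurable_funD => //.
  by apply: measurableT_comp => //; exact: measurable_dotv.
(* The constant 1 makes the integrand nonnegative; it cancels at the end. *)
pose f (p : 'cV[R]_n * R) := (1 + 1 * cos (dotv t p.1 + p.2))%:E.
have mf : measurable_fun setT f.
  apply/measurable_EFinP; apply: measurable_funD => //; apply: measurable_funM => //.
  by apply: measurableT_comp => //; exact: measurable_cos.
have f0 p : (0 <= f p)%E by rewrite lee_fin wave_ge0// normr1.
have : (\int[P]_w f (X w, Z w) =
    \int[P]_w (1 + expR (- dotv t (Sigma *m t) / 2) * cos (Z w))%:E)%E.
  rewrite ge0_integral_independent2//; apply: eq_integral => w _.
  rewrite (@ge0_integral_density _ _ _ (distribution P X) (lebesgue_cV R n)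
    (mvnormal_pdf 0 Sigma) (fun x => f (x, Z w))).
  - under eq_integral do rewrite -EFinM.
    by rewrite integral_mvnormal_wave ?normr1// mul1r.
  - exact: measurable_mvnormal_pdf.
  - by move=> x; exact: mvnormal_pdf_ge0.
  - exact: nX.
  - by apply: measurableT_comp => //; exact: measurable_pair2.
  - by move=> x; exact: f0.
rewrite (@integral_wave (fun w => dotv t (X w) + Z w))// integral_wave//.
by case; rewrite mul1r => /addrI.
Qed.

Lemma cexp_imaginary (a : R) : cexp ('i * a%:C)%C = (cos a +i* sin a)%C.
Proof. by rewrite /cexp; simpc; rewrite /= expR0; simpc. Qed.

Lemma cexp_real (a : R) : cexp (- a%:C)%C = ((expR (- a))%:C)%C.
Proof. by rewrite /cexp; simpc; rewrite /= cos0 sin0; simpc. Qed.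

(** A sine is a cosine with phase - pi / 2, so that one formula with an
    arbitrary phase covers real and imaginary parts. *)
Lemma cexpectation_phase (g : Omega -> R) :
  cexpectation P (fun w => cexp ('i * (g w)%:C)%C) =
  (\int[P]_w cos (g w) +i* \int[P]_w cos (g w - pi / 2))%C.
Proof.
rewrite /cexpectation unlock /Rintegral.
congr (fine _ +i* fine _)%C; apply: eq_integral => w _;
  rewrite cexp_imaginary//=.
by rewrite cosB cos_pihalf sin_pihalf mulr0 mulr1 add0r.
Qed.

Lemma joint_cfE m n (Y1 : Omega -> 'cV[R]_m) (Y2 : Omega -> 'cV[R]_n) t1 t2 :
  joint_cf P Y1 Y2 t1 t2 =
  cexpectation P (fun w => cexp ('i * (dotv t1 (Y1 w) + dotv t2 (Y2 w))%:C)%C).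
Proof.
congr cexpectation; apply/funext => w; rewrite -mulrDr.
by congr (cexp ('i%C * _)); simpc.
Qed.

Lemma joint_cf_sym m n (Y1 : Omega -> 'cV[R]_m) (Y2 : Omega -> 'cV[R]_n) t1 t2 :
  joint_cf P Y1 Y2 t1 t2 = joint_cf P Y2 Y1 t2 t1.
Proof. by rewrite !joint_cfE; under eq_fun do rewrite addrC. Qed.

(** The blocks of Y seen on the almost sure event N: a translated normal block
    Y1, and a block Y2 which equals Z, independent of the normal vector X.  Both
    cases of the theorem have this form, with the roles of the blocks
    exchanged. *)
Section shifted_normal_block.
Variables (m n : nat) (Sigma : 'M[R]_m) (xi : 'cV[R]_m).
Variables (X Y1 : {mfun Omega >-> 'cV[R]_m}) (Z Y2 : {mfun Omega >-> 'cV[R]_n}).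
Variable N : set Omega.
Hypotheses (pS : symmetric_posdef Sigma) (nX : mvnormal P 0 Sigma X).
Hypotheses (XZ : independent2 P X Z).
Hypotheses (mN : measurable N) (PN : P N = 1%E).
Hypotheses (Y1E : forall w, N w -> Y1 w = xi + X w).
Hypotheses (Y2E : forall w, N w -> Y2 w = Z w).

Let mshift : measurable_fun setT (fun v : 'cV[R]_m => xi + v).
Proof.
apply: measurable_fun_mxP => i j; under eq_fun do rewrite mxE.
by apply: measurable_funD => //; exact: measurable_mx_coord.
Qed.

Lemma independent2_shift : independent2 P Y1 Y2.
Proof.
move=> A B mA mB.
have mA' : measurable ((fun w => xi + X w) @^-1` A).
  by apply: measurable_preimage => //; exact: measurableT_comp.
have XZ' := independent2_comp mshift (@measurable_id _ _ setT) XZ.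
rewrite (@probability_eq_on _ _ _ P N _
  (((fun w => xi + X w) @^-1` A) `&` (Z @^-1` B)))//.
- rewrite (@probability_eq_on _ _ _ P N (Y1 @^-1` A)
    ((fun w => xi + X w) @^-1` A))//.
  + rewrite (@probability_eq_on _ _ _ P N (Y2 @^-1` B) (Z @^-1` B))//.
    * exact: XZ'.
    * exact: measurable_preimage.
    * exact: measurable_preimage.
    * by apply/seteqP; split => w /= [+ Nw]; rewrite Y2E.
  + exact: measurable_preimage.
  + by apply/seteqP; split => w /= [+ Nw]; rewrite Y1E.
- by apply: measurableI; exact: measurable_preimage.
- by apply: measurableI => //; exact: measurable_preimage.
- by apply/seteqP; split => w /= [+ Nw]; rewrite Y1E// Y2E.
Qed.

Lemma mvnormal_shift : mvnormal P xi Sigma Y1.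
Proof.
move=> B mB; rewrite -(mvnormal_translate xi nX mB).
apply: (@probability_eq_on _ _ _ P N) => //.
- exact: measurable_preimage.
- by apply: measurable_preimage => //; exact: measurableT_comp.
- by apply/seteqP; split => w /= [+ Nw]; rewrite Y1E.
Qed.

Lemma joint_cf_shift t1 t2 : xi = 0 ->
  joint_cf P Y1 Y2 t1 t2 = normal_cf Sigma t1 * cf P Y2 t2.
Proof.
move=> xi0; rewrite joint_cfE cexpectation_phase /cf cexpectation_phase.
rewrite /normal_cf cexp_real.
have mdX (n' : nat) (V : {mfun Omega >-> 'cV[R]_n'}) (t : 'cV[R]_n') :
    measurable_fun setT (fun w => dotv t (V w)).
  by apply: measurableT_comp => //; exact: measurable_dotv.
have key c : \int[P]_w cos (dotv t1 (Y1 w) + dotv t2 (Y2 w) + c) =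
    expR (- (2^-1 * dotv t1 (Sigma *m t1))) *
    \int[P]_w cos (dotv t2 (Y2 w) + c).
  have mg : measurable_fun setT (fun v => dotv t2 v + c).
    by apply: measurable_funD => //; exact: measurable_dotv.
  have mZc : measurable_fun setT (fun w => dotv t2 (Z w) + c).
    by apply: measurable_funD => //; exact: mdX.
  pose Zc : {mfun Omega >-> R} := HB.pack (fun w => dotv t2 (Z w) + c)
    (isMeasurableFun.Build _ _ _ _ _ mZc).
  have XZc : independent2 P X Zc.
    exact: (independent2_comp (@measurable_id _ _ setT) mg XZ).
  have := Rintegral_normal_phase t1 pS nX XZc.
  rewrite (_ : - dotv t1 (Sigma *m t1) / 2 =
    - (2^-1 * dotv t1 (Sigma *m t1))); last by ring.
  have mcos (g : Omega -> R) :
      measurable_fun setT g -> measurable_fun setT (cos \o g).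
    by move=> mg'; apply: measurableT_comp => //; exact: measurable_cos.
  rewrite (@Rintegral_eq_on _ _ _ P N
    (fun w => cos (dotv t1 (Y1 w) + dotv t2 (Y2 w) + c))
    (fun w => cos (dotv t1 (X w) + Zc w)))//; last 3 first.
  - apply: mcos; apply: measurable_funD => //; apply: measurable_funD; exact: mdX.
  - by apply: mcos; apply: measurable_funD => //; exact: mdX.
  - by move=> w Nw; rewrite Y1E// Y2E// xi0 add0r /= addrA.
  move=> ->; congr (_ * _); apply: (@Rintegral_eq_on _ _ _ P N) => //.
  - exact: mcos.
  - by apply: mcos; apply: measurable_funD => //; exact: mdX.
  - by move=> w Nw; rewrite Y2E.
have add0 (g : Omega -> R) : \int[P]_w cos (g w) = \int[P]_w cos (g w + 0).
  by apply: eq_Rintegral => w _; rewrite addr0.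
rewrite (add0 (fun w => dotv t1 (Y1 w) + dotv t2 (Y2 w))).
rewrite (add0 (fun w => dotv t2 (Y2 w))) !key.
by simpc.
Qed.

End shifted_normal_block.

End cf.

(** * The blocks of a generalized mixture of normals *)

Section gmn.
Context {R : realType} (dO : measure_display) (Omega : measurableType dO)
  (P : probability Omega R).

Lemma measurable_affine n (xi gamma : 'cV[R]_n) (r : {mfun (R * R)%type >-> R}) :
  measurable_fun setT (fun p : 'cV[R]_n * (R * R) => xi + r p.2 *: gamma + p.1).
Proof.
apply: measurable_fun_mxP => i j; under eq_fun do rewrite !mxE.
apply: measurable_funD.
  apply: measurable_funD => //; apply: measurable_funM => //.
  exact: measurableT_comp.
by apply: (measurableT_comp (measurable_mx_coord i j)); exact: measurable_fst.
Qed.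

Lemma independent3_pair d1 d2 d3 (T1 : measurableType d1) (T2 : measurableType d2)
    (T3 : measurableType d3) (X : {mfun Omega >-> T1}) (U : {mfun Omega >-> T2})
    (V : {mfun Omega >-> T3}) :
  independent3 P X U V -> independent2 P X (fun w => (U w, V w)).
Proof.
move=> XUV; apply: independent2_pair => A B C mA mB mC.
rewrite setIA XUV//.
have := XUV setT B C measurableT mB mC.
rewrite preimage_setT setTI => ->.
by rewrite probability_setT mul1e muleA.
Qed.

Lemma independent2_drop_pair d1 d2 d3 (T1 : measurableType d1) (T2 : measurableType d2)
    (T3 : measurableType d3) (X1 : {mfun Omega >-> T1}) (X2 : {mfun Omega >-> T2})
    (W : {mfun Omega >-> T3}) :
  independent2 P X1 X2 -> independent2 P (fun w => (X1 w, X2 w)) W ->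
  independent2 P X1 (fun w => (X2 w, W w)).
Proof.
move=> X12 XW; apply: independent2_pair => A B C mA mB mC.
have := XW (A `*` B) C (measurableX mA mB) mC.
have := XW (setT `*` B) C (measurableX measurableT mB) mC.
rewrite (_ : _ @^-1` (setT `*` B) = X2 @^-1` B); last first.
  by apply/seteqP; split => w /=; [case|].
rewrite (_ : _ @^-1` (A `*` B) = X1 @^-1` A `&` X2 @^-1` B)//.
by rewrite X12// setIA => -> ->; rewrite muleA.
Qed.

End gmn.

Theorem proposition3 (R : realType) (dO : measure_display)
    (Omega : measurableType dO) (P : probability Omega R) (d1 d2 : nat)
    (xi : 'cV[R]_(d1 + d2)) (Sigma : 'M[R]_(d1 + d2))
    (gamma : 'cV[R]_(d1 + d2)) (H : probability (R * R)%type R)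
    (X : {RV P >-> 'cV[R]_(d1 + d2)}) (U V : {RV P >-> R})
    (r s : {mfun (R * R)%type >-> R}) (Y : Omega -> 'cV[R]_(d1 + d2))
    (hY : GMN xi Sigma gamma H X U V r s Y)
    (hS : P [set w | s (U w, V w) = 1] = 1%E)
    (hSigma12 : ursubmx Sigma = 0)
    (hgamma : usubmx gamma = 0 \/ dsubmx gamma = 0) :
  let Y1 := fun w => usubmx (Y w) in
  let Y2 := fun w => dsubmx (Y w) in
  [/\ independent2 P Y1 Y2,
      xi = 0 ->
        (usubmx gamma = 0 -> forall t1 t2,
           joint_cf P Y1 Y2 t1 t2 =
           normal_cf (ulsubmx Sigma) t1 * cf P Y2 t2) /\
        (dsubmx gamma = 0 -> forall t1 t2,
           joint_cf P Y1 Y2 t1 t2 =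
           cf P Y1 t1 * normal_cf (drsubmx Sigma) t2) &
      usubmx gamma = 0 -> dsubmx gamma = 0 ->
        [/\ independent2 P Y1 Y2,
            mvnormal P (usubmx xi) (ulsubmx Sigma) Y1 &
            mvnormal P (dsubmx xi) (drsubmx Sigma) Y2]].
Proof.
move=> Y1 Y2; case: hY => pS nX XUV s0 _ YE.
have p11 := posdef_ulsubmx pS; have p22 := posdef_drsubmx pS.
have mW : measurable_fun setT (fun w => (U w, V w)).
  exact: measurable_fun_pair.
pose W : {mfun Omega >-> (R * R)%type} := HB.pack (fun w => (U w, V w))
  (isMeasurableFun.Build _ _ _ _ _ mW).
pose N := [set w | s (W w) = 1].
have PN : P N = 1%E by exact: hS.
have mN : measurable N.
  have : measurable ((s \o W) @^-1` [set 1]).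
    by apply: measurable_preimage => //; exact: measurableT_comp.
  by [].
have mY : measurable_fun setT Y.
  rewrite (funext YE); apply: measurable_fun_mxP => i j.
  under eq_fun do rewrite !mxE.
  apply: measurable_funD.
    apply: measurable_funD => //; apply: measurable_funM => //.
    exact: (measurableT_comp (measurable_funPT r) mW).
  apply: measurable_funM; first exact: (measurableT_comp (measurable_funPT s) mW).
  exact: (measurableT_comp (measurable_mx_coord i j) (measurable_funPT X)).
have mu := @measurable_usubmx R d1 d2; have md := @measurable_dsubmx R d1 d2.
pose X1 : {mfun Omega >-> 'cV[R]_d1} := HB.pack (fun w => usubmx (X w))
  (isMeasurableFun.Build _ _ _ _ _ (measurableT_comp mu (measurable_funPT X))).
pose X2 : {mfun Omega >-> 'cV[R]_d2} := HB.pack (fun w => dsubmx (X w))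
  (isMeasurableFun.Build _ _ _ _ _ (measurableT_comp md (measurable_funPT X))).
pose Y1' : {mfun Omega >-> 'cV[R]_d1} := HB.pack Y1
  (isMeasurableFun.Build _ _ _ _ _ (measurableT_comp mu mY)).
pose Y2' : {mfun Omega >-> 'cV[R]_d2} := HB.pack Y2
  (isMeasurableFun.Build _ _ _ _ _ (measurableT_comp md mY)).
have nX1 : mvnormal P 0 (ulsubmx Sigma) X1 by exact: mvnormal_usubmx.
have nX2 : mvnormal P 0 (drsubmx Sigma) X2 by exact: mvnormal_dsubmx.
have X12 : independent2 P X1 X2 by exact: (independent2_blocks pS).
have XW : independent2 P X W := independent3_pair XUV.
have mud : measurable_fun setT
    (fun v : 'cV[R]_(d1 + d2) => (usubmx v, dsubmx v)).
  exact: measurable_fun_pair.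
have mdu : measurable_fun setT
    (fun v : 'cV[R]_(d1 + d2) => (dsubmx v, usubmx v)).
  exact: measurable_fun_pair.
have ind12 : independent2 P X1 (fun w => (X2 w, W w)).
  apply: independent2_drop_pair => //.
  exact: (independent2_comp mud (@measurable_id _ _ setT) XW).
have ind21 : independent2 P X2 (fun w => (X1 w, W w)).
  apply: independent2_drop_pair; first exact: independent2_sym.
  exact: (independent2_comp mdu (@measurable_id _ _ setT) XW).
have mg2 := measurable_affine (dsubmx xi) (dsubmx gamma) r.
have mg1 := measurable_affine (usubmx xi) (usubmx gamma) r.
(* Z1 and Z2 are the blocks of Y with S replaced by 1. *)
pose Z2 : {mfun Omega >-> 'cV[R]_d2} := HB.pack
  (fun w => dsubmx xi + r (W w) *: dsubmx gamma + X2 w)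
  (isMeasurableFun.Build _ _ _ _ _ (measurableT_comp mg2
    (measurable_fun_pair (measurable_funPT X2) (measurable_funPT W)))).
pose Z1 : {mfun Omega >-> 'cV[R]_d1} := HB.pack
  (fun w => usubmx xi + r (W w) *: usubmx gamma + X1 w)
  (isMeasurableFun.Build _ _ _ _ _ (measurableT_comp mg1
    (measurable_fun_pair (measurable_funPT X1) (measurable_funPT W)))).
have XZ2 : independent2 P X1 Z2.
  exact: (independent2_comp (@measurable_id _ _ setT) mg2 ind12).
have XZ1 : independent2 P X2 Z1.
  exact: (independent2_comp (@measurable_id _ _ setT) mg1 ind21).
have Y1Z w : N w -> Y1' w = Z1 w.
  by move=> Nw; rewrite /= /Y1 YE Nw scale1r !linearD linearZ.
have Y2Z w : N w -> Y2' w = Z2 w.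
  by move=> Nw; rewrite /= /Y2 YE Nw scale1r !linearD linearZ.
have Y1X : usubmx gamma = 0 -> forall w, N w -> Y1' w = usubmx xi + X1 w.
  by move=> g0 w /Y1Z ->; rewrite /= g0 scaler0 addr0.
have Y2X : dsubmx gamma = 0 -> forall w, N w -> Y2' w = dsubmx xi + X2 w.
  by move=> g0 w /Y2Z ->; rewrite /= g0 scaler0 addr0.
have indY : independent2 P Y1 Y2.
  case: hgamma => g0; first exact: (independent2_shift XZ2 mN PN (Y1X g0) Y2Z).
  exact/independent2_sym/(independent2_shift XZ1 mN PN (Y2X g0) Y1Z).
split; first exact: indY.
- move=> xi0; split => g0 t1 t2.
    by apply: (joint_cf_shift p11 nX1 XZ2 mN PN (Y1X g0) Y2Z); rewrite xi0 linear0.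
  rewrite joint_cf_sym mulrC.
  by apply: (joint_cf_shift p22 nX2 XZ1 mN PN (Y2X g0) Y1Z); rewrite xi0 linear0.
- move=> g1 g2; split; first exact: indY.
    exact: (mvnormal_shift nX1 mN PN (Y1X g1)).
  exact: (mvnormal_shift nX2 mN PN (Y2X g2)).
Qed.
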